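(* Fix an integer $k\ge1$ and $\alpha>0$, and put $a:=\alpha^2$, $q_n:=\sqrt{2\log n}$ and $$\mathcal C_{n,k}:=\Big\{\frac{A_S}{q_n}:\ S\subset[n],\ |S|=k\Big\}.$$ Then $d_{\mathrm H}\big(\mathcal C_{n,k},\mathcal K_k(a)\big)\to0$ in probability as $n\to\infty$.
   Context: For every $n\ge k$, $A=(A_{ij})_{1\le i,j\le n}$ is a real symmetric random matrix with $A_{ij}=A_{ji}\sim N(0,1)$ for $1\le i<j\le n$ and $A_{ii}\sim N(0,\alpha^2)$ for $1\le i\le n$, all random variables on and above the diagonal being independent. For $S\subset[n]=\{1,\dots,n\}$ with $|S|=k$, $A_S$ is the principal submatrix indexed by $S$, regarded as a $k\times k$ matrix (indices of $S$ in increasing order). For a real symmetric $k\times k$ matrix $B$ and $U\subset[k]$, put $$\mathcal I_{U,a}(B):=\frac1a\sum_{i\in U}B_{ii}^2+\sum_{i<j,\ i,j\in U}B_{ij}^2,$$ $$\mathcal K_k(a):=\{B=B^\top\in\mathbb R^{k\times k}:\ \mathcal I_{U,a}(B)\le|U|\text{ for every }\varnothing\ne U\subset[k]\}.$$ For nonempty subsets $P,Q$ of the space of real symmetric $k\times k$ matrices with the metric $d$ induced by the Frobenius norm, the Hausdorff distance is $$d_{\mathrm H}(P,Q):=\max\Big\{\sup_{x\in P}\inf_{y\in Q}d(x,y),\ \sup_{y\in Q}\inf_{x\in P}d(x,y)\Big\}.$$ *)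

(* Defs.v *)
From HB Require Import structures.
From mathcomp Require Import all_boot all_order all_algebra.
From mathcomp Require Import all_classical all_reals all_analysis.

Set Implicit Arguments.
Unset Strict Implicit.
Unset Printing Implicit Defensive.

Import Order.TTheory GRing.Theory Num.Theory.
Import numFieldNormedType.Exports.

Local Open Scope classical_set_scope.
Local Open Scope ring_scope.

(* The product rule is required for every finite subfamily J of the index set
   D and every choice of Borel sets. *)
Definition mutually_independent (R : realType) (d : measure_display)
    (T : measurableType d) (P : probability T R) (I : finType) (D : {set I})
    (X : I -> {RV P >-> R}) : Prop :=
  forall (J : {set I}) (B : I -> set R), (J \subset D)%SET ->
    (forall i, measurable (B i)) ->
    P [set w | forall i, i \in J -> B i (X i w)] =
    (\prod_(i in J) P (X i @^-1` B i))%E.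

(* Equality of laws is only meaningful on Borel sets: the library's measures
   are total functions on all subsets. *)
Definition has_law (R : realType) (d : measure_display) (T : measurableType d)
    (P : probability T R) (X : {RV P >-> R}) (mu : set R -> \bar R) : Prop :=
  forall B : set R, measurable B -> distribution P X B = mu B.

(* The second argument of [normal_prob] is the standard deviation, so that
   [normal_prob 0 alpha] is N(0, alpha^2). *)
Definition gaussian_symmetric_ensemble (R : realType) (alpha : R) (n : nat)
    (d : measure_display) (T : measurableType d) (P : probability T R)
    (A : 'I_n -> 'I_n -> {RV P >-> R}) : Prop :=
  [/\ forall (i j : 'I_n) w, A i j w = A j i w,
      forall i j : 'I_n, (i < j)%N -> has_law (A i j) (normal_prob 0 1),
      forall i, has_law (A i i) (normal_prob 0 alpha) &
      mutually_independent [set ij : 'I_n * 'I_n | (ij.1 <= ij.2)%N]%SET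
        (fun ij => A ij.1 ij.2)].

Definition random_matrix (R : realType) (n : nat) (d : measure_display)
    (T : measurableType d) (P : probability T R)
    (A : 'I_n -> 'I_n -> {RV P >-> R}) (w : T) : 'M[R]_n :=
  \matrix_(i, j) A i j w.

(* [enum_val] lists the elements of S in increasing order. *)
Definition principal_submx (R : realType) (n k : nat) (M : 'M[R]_n)
    (S : {set 'I_n}) (hS : #|S| = k) : 'M[R]_k :=
  let f (i : 'I_k) : 'I_n := enum_val (cast_ord (esym hS) i) in
  mxsub f f M.

Definition scale_q (R : realType) (n : nat) : R := Num.sqrt (2 * ln n%:R).

Definition submx_cloud (R : realType) (n k : nat) (M : 'M[R]_n) :
    set 'M[R]_k :=
  [set B | exists (S : {set 'I_n}) (hS : #|S| = k),
     B = (scale_q R n)^-1 *: principal_submx M hS].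

Definition energy (R : realType) (k : nat) (U : {set 'I_k}) (a : R)
    (B : 'M[R]_k) : R :=
  a^-1 * (\sum_(i in U) B i i ^+ 2) +
  \sum_(i in U) \sum_(j in U | (i < j)%N) B i j ^+ 2.

Definition limit_body (R : realType) (k : nat) (a : R) : set 'M[R]_k :=
  [set B | B^T = B /\
     forall U : {set 'I_k}, U != finset.set0 -> energy U a B <= #|U|%:R].

(* The library's own norm on matrices is the entrywise maximum. *)
Definition frobenius_dist (R : realType) (k : nat) (x y : 'M[R]_k) : R :=
  Num.sqrt (\sum_(i < k) \sum_(j < k) (x i j - y i j) ^+ 2).

(* Suprema and infima are taken in the extended reals, so no boundedness
   side condition is needed. *)
Definition hausdorff_dist (R : realType) (V : Type) (dist : V -> V -> R)
    (P Q : set V) : \bar R :=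
  maxe (ereal_sup [set ereal_inf [set (dist x y)%:E | y in Q] | x in P])
       (ereal_sup [set ereal_inf [set (dist x y)%:E | x in P] | y in Q]).

(* The variables X n may live on different probability spaces. *)
Definition cvg_in_probability (R : realType) (d : nat -> measure_display)
    (T : forall n, measurableType (d n)) (P : forall n, probability (T n) R)
    (X : forall n, T n -> \bar R) (l : R) : Prop :=
  forall eps : R, 0 < eps ->
    (fun n => P n [set w | (eps%:E < `|X n w - l%:E|)%E]) @ \oo --> 0%E.

(* Main.v *)
Require Import Defs.
From mathcomp Require Import all_boot all_order all_algebra.
From mathcomp Require Import all_classical all_reals all_analysis.
From mathcomp Require Import measurable_realfun.
From mathcomp Require Import ring lra.

(** Write [L = ln n], so that the scale is [q = sqrt (2 L)].  A centred Gaussian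
    of standard deviation [s] is near [q x] with probability about
    [expR (- L * (x / s) ^+ 2) = n ^ (- (x / s) ^+ 2)].  By independence, the
    principal submatrix carried by [u] given rows is near [q B] with
    probability about [n ^ (- energy of B)], while there are about [n ^ u]
    ways of choosing the rows.  A matrix [B] is therefore approximated by some
    [A_S / q] when this competition is won for every subset [U] of positions
    (for if some [U] loses, no choice of the rows in [U] alone is suitable),
    and this is what the limit body expresses.

    The cloud is near the body, by a first moment ([energy_upper_bound]): a
    given list of [u] rows has energy above [u + delta] with probability
    [O(n ^ (- u - delta / 2))], and a union bound runs over the [n ^ u] lists.
    Hence the whole cloud satisfies the constraints relaxed by [delta], and
    [limit_body_shrink] brings it back into the body by a small contraction.
    For a single list, [discretize_sum] covers the event that a sum of squares
    is large by finitely many events, each of which bounds every square from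
    below; independence, given as a product rule for events, applies to these
    directly.

    The body is near the cloud, by a second moment ([approximation_bound],
    resting on [no_hit_prob]).  The [n] rows are cut into [k] blocks of [m]
    rows and only the transversals of the blocks are considered, so that two
    of them can share rows only at equal positions.  If they share exactly the
    positions in [U], the two approximation events are correlated by the factor
    [1 / p_U], where [p_U] is the probability that the entries indexed by [U]
    are right; a fraction at most [m ^ (- #|U|)] of the pairs agrees on [U].
    So the probability that no transversal works is at most the sum over
    nonempty [U] of [1 / (m ^ #|U| * p_U)].  For a target [(1 - eta) y] with
    [y] in the body, [p_U] is at least of order [n ^ (- #|U| + eta / 2)], and
    the sum is [O(n ^ (- eta / 2))].

    The body being bounded, a finite net reduces its approximation to
    finitely many targets ([finite_net]), and [hausdorff_cloud_le] compares
    distances outside the exceptional events.  A measure is monotone on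
    measurable sets only, so the event of a large Hausdorff distance has to be
    shown measurable: it is an open condition on the matrix
    ([hausdorff_gt_open], [measurable_random_matrix_open]). *)

Set Implicit Arguments.
Unset Strict Implicit.
Unset Printing Implicit Defensive.

Import Order.TTheory GRing.Theory Num.Theory.
Import numFieldNormedType.Exports.

Local Open Scope classical_set_scope.
Local Open Scope ring_scope.

(** * Frobenius and Hausdorff distances *)

Section Frobenius.
Context {R : realType} {k : nat}.
Implicit Types x y z : 'M[R]_k.

Lemma frobenius_dist_ge0 x y : 0 <= frobenius_dist x y.
Proof. exact: sqrtr_ge0. Qed.

(** Lagrange's identity: the difference of the two sides is half the sum of
    the squares [(u i * v j - u j * v i) ^+ 2]. *)
Lemma cauchy_schwarz_sum (I : finType) (u v : I -> R) :
  (\sum_i u i * v i) ^+ 2 <= (\sum_i u i ^+ 2) * (\sum_i v i ^+ 2).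
Proof.
have : 0 <= \sum_i \sum_j (u i * v j - u j * v i) ^+ 2.
  by apply: sumr_ge0 => i _; apply: sumr_ge0 => j _; exact: sqr_ge0.
have -> : \sum_i \sum_j (u i * v j - u j * v i) ^+ 2 =
    2 * ((\sum_i u i ^+ 2) * (\sum_i v i ^+ 2) - (\sum_i u i * v i) ^+ 2).
  have sq i : \sum_j (u i * v j - u j * v i) ^+ 2 =
      u i ^+ 2 * (\sum_j v j ^+ 2) + v i ^+ 2 * (\sum_j u j ^+ 2)
      - 2 * (u i * v i) * (\sum_j u j * v j).
    rewrite !mulr_sumr -big_split /= -sumrB; apply: eq_bigr => j _; ring.
  rewrite (eq_bigr _ (fun i _ => sq i)) sumrB big_split /= -!mulr_suml.
  rewrite -mulr_sumr; ring.
by rewrite pmulr_rge0 // subr_ge0.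
Qed.

Lemma minkowski_sum (I : finType) (u v : I -> R) :
  Num.sqrt (\sum_i (u i + v i) ^+ 2) <=
  Num.sqrt (\sum_i u i ^+ 2) + Num.sqrt (\sum_i v i ^+ 2).
Proof.
set a := \sum_i u i ^+ 2; set b := \sum_i v i ^+ 2.
have a0 : 0 <= a by apply: sumr_ge0 => i _; exact: sqr_ge0.
have b0 : 0 <= b by apply: sumr_ge0 => i _; exact: sqr_ge0.
rewrite -(@ler_pXn2r _ 2) ?nnegrE ?addr_ge0 ?sqrtr_ge0 //.
rewrite sqrrD !sqr_sqrtr //; last by apply: sumr_ge0 => i _; exact: sqr_ge0.
have -> : \sum_i (u i + v i) ^+ 2 = a + (\sum_i u i * v i) *+ 2 + b.
  by rewrite -sumrMnl -!big_split /=; apply: eq_bigr => i _; rewrite sqrrD.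
rewrite lerD2r lerD2l lerMn2r /= -sqrtrM //.
apply: le_trans (ler_norm _) _; rewrite -sqrtr_sqr.
by apply: ler_wsqrtr; exact: cauchy_schwarz_sum.
Qed.

Lemma frobenius_dist_triangle y x z :
  frobenius_dist x z <= frobenius_dist x y + frobenius_dist y z.
Proof.
rewrite /frobenius_dist !pair_bigA /=.
rewrite (eq_bigr (fun p : 'I_k * 'I_k =>
  ((x p.1 p.2 - y p.1 p.2) + (y p.1 p.2 - z p.1 p.2)) ^+ 2)).
  exact: minkowski_sum.
by move=> p _; rewrite addrA subrK.
Qed.

Lemma frobenius_distC x y : frobenius_dist x y = frobenius_dist y x.
Proof.
congr Num.sqrt; apply: eq_bigr => i _; apply: eq_bigr => j _.
by rewrite -sqrrN opprB.
Qed.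

Lemma frobenius_dist_le x y (r : R) : 0 <= r ->
  (forall i j, `|x i j - y i j| <= r) -> frobenius_dist x y <= k%:R * r.
Proof.
move=> r0 xy.
have kr0 : 0 <= k%:R * r by rewrite mulr_ge0.
rewrite -[leRHS]ger0_norm // -sqrtr_sqr.
apply: ler_wsqrtr.
apply: (@le_trans _ _ (\sum_(i < k) \sum_(j < k) r ^+ 2)).
  apply: ler_sum => i _; apply: ler_sum => j _.
  by rewrite -real_normK ?num_real // ler_pXn2r ?nnegrE.
rewrite !sumr_const card_ord -mulrnA exprMn -(mulr_natl (r ^+ 2)).
by rewrite natrM expr2.
Qed.

End Frobenius.

(** Unfolds the suprema and infima once and for all.  The strict gap between
    [eps] and [e] is what makes the condition open. *)
Lemma hausdorff_dist_gtP (R : realType) (V : Type) (d : V -> V -> R)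
    (P Q : set V) (eps : R) :
  (eps%:E < hausdorff_dist d P Q)%E <->
  exists2 e, eps < e & (exists2 x, P x & forall y, Q y -> e <= d x y) \/
                       (exists2 y, Q y & forall x, P x -> e <= d x y).
Proof.
have far (W : Type) (S : set W) (f : W -> R) :
    (eps%:E < ereal_inf [set (f y)%:E | y in S])%E <->
    exists2 e, eps < e & forall y, S y -> e <= f y.
  split=> [h|[e eps_e h]].
    have [e eps_e he] : exists2 e, eps < e &
        (e%:E <= ereal_inf [set (f y)%:E | y in S])%E.
      case: ereal_inf h => [r| |] // h.
        by exists r; rewrite ?lee_fin -?lte_fin.
      by exists (eps + 1); rewrite ?ltrDl ?leey.
    exists e => // y Sy; rewrite -lee_fin; apply: le_trans he _.
    by apply: ereal_inf_lbound; exists y.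
  apply: (@lt_le_trans _ _ e%:E); first by rewrite lte_fin.
  by apply: le_ereal_inf_tmp => _ [y Sy <-]; rewrite lee_fin h.
rewrite /hausdorff_dist lt_max; split.
  case/orP => /ereal_sup_gt [_ [x Px <-]] /far [e eps_e h]; exists e => //.
    by left; exists x.
  by right; exists x.
move=> [e eps_e [[x Px h]|[y Qy h]]]; apply/orP; [left|right].
  apply: (@lt_le_trans _ _ (ereal_inf [set (d x y)%:E | y in Q])).
    by apply/far; exists e.
  by apply: ereal_sup_ubound; exists x.
apply: (@lt_le_trans _ _ (ereal_inf [set (d x y)%:E | x in P])).
  by apply/(far _ P (d^~ y)); exists e.
by apply: ereal_sup_ubound; exists y.
Qed.

Lemma hausdorff_dist_ge0 (R : realType) (V : Type) (d : V -> V -> R)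
    (P Q : set V) : (forall x y, 0 <= d x y) -> Q !=set0 ->
  (0 <= hausdorff_dist d P Q)%E.
Proof.
move=> d0 [y Qy]; rewrite /hausdorff_dist le_max; apply/orP; right.
apply: (@le_trans _ _ (ereal_inf [set (d x y)%:E | x in P])).
  by apply: le_ereal_inf_tmp => _ [x _ <-]; rewrite lee_fin.
by apply: ereal_sup_ubound; exists y.
Qed.

(** * Open conditions on a random matrix *)

(** An open set of matrices is a countable union of boxes with rational
    corners, and each box is a finite intersection of conditions on single
    entries. *)
Lemma measurable_random_matrix_open (R : realType) (n : nat)
    (d : measure_display) (T : measurableType d) (P : probability T R)
    (A : 'I_n -> 'I_n -> {RV P >-> R}) (O : set 'M[R]_n) :
  (forall M, O M -> exists2 r : R, 0 < r &
     forall M' : 'M[R]_n, (forall i j, `|M' i j - M i j| < r) -> O M') ->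
  measurable [set w | O (random_matrix A w)].
Proof.
move=> openO.
pose box (b : {ffun 'I_n * 'I_n -> rat * rat}) : set 'M[R]_n :=
  [set M | forall ij, ratr (b ij).1 < M ij.1 ij.2 < ratr (b ij).2].
pose F (b : {ffun 'I_n * 'I_n -> rat * rat}) : set T :=
  [set w | box b `<=` O /\ box b (random_matrix A w)].
have -> : [set w | O (random_matrix A w)] = \bigcup_b F b.
  apply/seteqP; split => w /=; last by move=> [b _ [bO bw]]; exact: bO.
  move=> /openO [r r0 rO]; set M := random_matrix A w in rO *.
  have /choice [b bP] : forall ij : 'I_n * 'I_n, exists c : rat * rat,
      M ij.1 ij.2 - r < ratr c.1 < M ij.1 ij.2 /\
      M ij.1 ij.2 < ratr c.2 < M ij.1 ij.2 + r.
    move=> ij.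
    have /rat_in_itvoo [c1 c1P] : M ij.1 ij.2 - r < M ij.1 ij.2.
      by rewrite ltrBlDr ltrDl.
    have /rat_in_itvoo [c2 c2P] : M ij.1 ij.2 < M ij.1 ij.2 + r.
      by rewrite ltrDl.
    by exists (c1, c2); move: c1P c2P; rewrite !in_itv.
  exists [ffun ij => b ij] => //; split => [M' M'b|ij].
    apply: rO => i j; have := M'b (i, j); have := bP (i, j).
    rewrite ffunE /= => -[/andP[c1 c2] /andP[c3 c4]] /andP[c5 c6].
    by rewrite ltr_norml; apply/andP; split; lra.
  by rewrite ffunE; have [/andP[_ ->] /andP[->]] := bP ij.
apply: countable_bigcupT_measurable => [|b]; first exact: countableP.
have [bO|bO] := pselect (box b `<=` O); last first.
  rewrite (_ : F b = set0) //; apply/seteqP; split => w // [bO' _].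
  exact: bO.
rewrite (_ : F b = \bigcap_(ij in [set: 'I_n * 'I_n])
    A ij.1 ij.2 @^-1` `]ratr (b ij).1, ratr (b ij).2[).
  by apply: fin_bigcap_measurable => // ij _; exact: measurable_funPTI.
apply/seteqP; split => w.
  by move=> [_ bw] ij _ /=; rewrite in_itv /=; have := bw ij; rewrite mxE.
move=> bw; split => // ij; have := bw ij I.
by rewrite /= in_itv /= mxE.
Qed.

(** * Gaussian estimates *)

Section GaussianEstimates.
Context {R : realType}.
Implicit Types (s t x y r : R) (m : R).

Let mu := @lebesgue_measure R.

Lemma measurable_sqr_ge t : measurable [set x : R | t <= x ^+ 2].
Proof.
have -> : [set x : R | t <= x ^+ 2] = (fun x : R => x ^+ 2) @^-1` `[t, +oo[.
  by apply/seteqP; split => x /=; rewrite in_itv /= andbT.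
rewrite -[X in measurable X]setTI.
by apply: exprn_measurable => //; exact: measurable_itv.
Qed.

Lemma measurable_dist_le y r : measurable [set x : R | `|x - y| <= r].
Proof.
have -> : [set x : R | `|x - y| <= r] = `[y - r, y + r]%classic.
  by apply/seteqP; split => x /=; rewrite in_itv /= ler_distl.
exact: measurable_itv.
Qed.

(** Where [m * (x - m)] is nonnegative, [x ^+ 2] is at least
    [m ^+ 2 + (x - m) ^+ 2], so the centred density is at most [expR] of the
    stated exponent times the density of mean [m], whose total mass is 1. *)
Lemma normal_prob_shift_le s m (D : set R) : s != 0 -> measurable D ->
  (forall x, D x -> 0 <= m * (x - m)) ->
  (normal_prob 0 s D <= (expR (- (m ^+ 2 / (s ^+ 2 *+ 2))))%:E)%E.
Proof.
move=> s0 mD Dm; set c := expR _.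
have mpdf m' : measurable_fun D (fun x => (normal_pdf m' s x)%:E).
  by apply/measurable_EFinP/measurable_funTS; exact: measurable_normal_pdf.
apply: (@le_trans _ _ (\int[mu]_(x in D) (c%:E * (normal_pdf m s x)%:E))%E).
  apply: ge0_le_integral => //.
  - by move=> x _; rewrite lee_fin normal_pdf_ge0.
  - exact: mpdf.
  - by apply: measurable_funeM; exact: mpdf.
  move=> x Dx; rewrite -EFinM lee_fin !normal_pdfE // mulrCA.
  apply: ler_wpM2l; first exact: normal_peak_ge0.
  rewrite /normal_fun /c -expRD ler_expR -(mulNr (m ^+ 2)) -mulrDl.
  apply: ler_wpM2r; first by rewrite invr_ge0 mulrn_wge0 // sqr_ge0.
  have := Dm x Dx; rewrite subr0; nra.
rewrite ge0_integralZl //.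
- rewrite -[leRHS]mule1; apply: lee_wpmul2l; first by rewrite lee_fin expR_ge0.
  exact: (@probability_le1 _ _ _ (normal_prob m s)).
- exact: mpdf.
- by move=> x _; rewrite lee_fin normal_pdf_ge0.
by rewrite lee_fin expR_ge0.
Qed.

(** The event is the union of two half-lines; shift the mean to the end point
    of each. *)
Lemma normal_prob_sqr_ge s t : s != 0 -> 0 <= t ->
  (normal_prob 0 s [set x | (t <= x ^+ 2)%R] <=
   (2 * expR (- (t / (s ^+ 2 *+ 2))))%:E)%E.
Proof.
move=> s0 t0.
have -> : [set x : R | t <= x ^+ 2] =
    `[Num.sqrt t, +oo[%classic `|` `]-oo, - Num.sqrt t]%classic.
  apply/seteqP; split => x /=; rewrite !in_itv /= andbT.
    rewrite -ler_sqrt ?sqr_ge0 // sqrtr_sqr ler_normr => /orP[|h]; [left|right] => //.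
    by rewrite lerNr.
  move=> h; rewrite -ler_sqrt ?sqr_ge0 // sqrtr_sqr ler_normr.
  by apply/orP; case: h => [|h]; [left|right] => //; rewrite lerNr.
apply: le_trans; first by apply: (@measureU2 _ _ _ (normal_prob 0 s)) => //.
rewrite mulr2n mulrDl !mul1r EFinD.
apply: leeD.
  rewrite -{2}(sqr_sqrtr t0); apply: normal_prob_shift_le => // x /=.
  by rewrite in_itv /= andbT => h; rewrite mulr_ge0 ?sqrtr_ge0 // subr_ge0.
rewrite -{2}(sqr_sqrtr t0) -sqrrN; apply: normal_prob_shift_le => // x /=.
rewrite in_itv /= => h; have := sqrtr_ge0 t; nra.
Qed.

(** On the interval the density is at least its value at distance [`|y| + r]
    from the mean. *)
Lemma normal_prob_near_ge s y r : s != 0 -> 0 < r ->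
  ((2 * r * normal_peak s * expR (- ((`|y| + r) ^+ 2 / (s ^+ 2 *+ 2))))%:E
   <= normal_prob 0 s [set x | (`|x - y| <= r)%R])%E.
Proof.
move=> s0 r0.
set c := normal_peak s * expR (- ((`|y| + r) ^+ 2 / (s ^+ 2 *+ 2))).
have E : [set x : R | `|x - y| <= r] = `[y - r, y + r]%classic.
  by apply/seteqP; split => x /=; rewrite in_itv /= ler_distl.
have -> : ((2 * r * normal_peak s * expR (- ((`|y| + r) ^+ 2 / (s ^+ 2 *+ 2))))%:E
   = \int[mu]_(x in [set x | (`|x - y| <= r)%R]) c%:E)%E.
  rewrite integral_cst /=; last exact: measurable_dist_le.
  rewrite E /mu lebesgue_measure_itv /= lte_fin.
  rewrite ifT; last by lra.
  rewrite -EFinD -EFinM; congr EFin; rewrite /c; ring.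
apply: ge0_le_integral.
- exact: measurable_dist_le.
- by move=> x _; rewrite lee_fin mulr_ge0 ?normal_peak_ge0 ?expR_ge0.
- exact: measurable_cst.
- by apply/measurable_EFinP/measurable_funTS; exact: measurable_normal_pdf.
move=> x /= xy; rewrite lee_fin normal_pdfE //.
apply: ler_wpM2l; first exact: normal_peak_ge0.
rewrite /normal_fun ler_expR subr0 mulNr lerN2.
apply: ler_wpM2r; first by rewrite invr_ge0 mulrn_wge0 // sqr_ge0.
rewrite -(real_normK (num_real x)) ler_pXn2r ?nnegrE ?addr_ge0 // ?(ltW r0) //.
by rewrite addrC -lerBlDr; apply: le_trans (ler_norm _) _;
   apply: le_trans xy; exact: ler_dist_dist.
Qed.

End GaussianEstimates.

(** * Moment inequalities for finitely many events *)

Section FiniteProbability.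
Context {R : realType} {d : measure_display} {T : measurableType d}
  (P : probability T R).

Lemma integral_sum_indic (I : finType) (c : I -> R) (E : I -> set T) :
  (forall i, 0 <= c i) -> (forall i, measurable (E i)) ->
  (\int[P]_w (\sum_i c i * \1_(E i) w)%:E)%E =
  (\sum_i c i * fine (P (E i)))%:E.
Proof.
move=> c0 mE.
under eq_integral do rewrite -sumEFin.
rewrite ge0_integral_sum //; last 2 first.
- move=> i; apply/measurable_EFinP/measurable_funM => //.
- by move=> i w _; rewrite lee_fin mulr_ge0.
rewrite -sumEFin; apply: eq_bigr => i _.
under eq_integral do rewrite EFinM.
rewrite ge0_integralZl //; last 2 first.
- by apply/measurable_EFinP.
- by rewrite lee_fin.
by rewrite integral_indic // setIT EFinM fineK ?fin_num_measure.
Qed.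

(** Expectation of a pointwise inequality.  The coefficients are nonnegative so
    that integrals of nonnegative functions suffice and no integrability has to
    be checked; an inequality with signs is first rearranged. *)
Lemma prob_le_of_indic_le (I J : finType) (c : I -> R) (e : J -> R)
    (E : I -> set T) (F : J -> set T) :
  (forall i, 0 <= c i) -> (forall j, 0 <= e j) ->
  (forall i, measurable (E i)) -> (forall j, measurable (F j)) ->
  (forall w, \sum_i c i * \1_(E i) w <= \sum_j e j * \1_(F j) w :> R) ->
  \sum_i c i * fine (P (E i)) <= \sum_j e j * fine (P (F j)).
Proof.
move=> c0 e0 mE mF cE.
have mS (K : finType) (b : K -> R) (G : K -> set T) :
    (forall k, measurable (G k)) ->
    measurable_fun [set: T] (fun w => (\sum_k b k * \1_(G k) w)%:E).
  move=> mG; apply/measurable_EFinP; apply: measurable_sum => k.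
  exact: measurable_funM.
rewrite -lee_fin -!integral_sum_indic //; apply: ge0_le_integral => //.
- by move=> w _; rewrite lee_fin sumr_ge0 // => i _; rewrite mulr_ge0.
- exact: mS.
- exact: mS.
by move=> w _; rewrite lee_fin.
Qed.

(** With [N] the number of events that occur and [m = #|F| * p] its mean,
    [(N - m) ^+ 2] is at least [m ^+ 2] where [N = 0].  Expanding the square and
    moving the negative term to the other side, this reads
    [m ^+ 2 * (N == 0) + 2 * m * N <= N ^+ 2 + m ^+ 2], whose expectation is
    the claim. *)
Lemma second_moment_bound (F : finType) (E : F -> set T) (p s : R) :
  (forall f, measurable (E f)) -> (0 < #|F|)%N -> 0 < p ->
  (forall f, fine (P (E f)) = p) ->
  \sum_f \sum_g fine (P (E f `&` E g)) <= (#|F|%:R * p) ^+ 2 * (1 + s) ->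
  fine (P [set w | forall f, ~ E f w]) <= s.
Proof.
move=> mE F0 p0 Ep Es; set Z := [set w | _].
have mZ : measurable Z.
  rewrite (_ : Z = \bigcap_(f in [set: F]) ~` E f).
    by apply: fin_bigcap_measurable => // f _; exact: measurableC.
  by apply/seteqP; split => w Zw f; [move=> _; exact: Zw | exact: Zw].
pose m := #|F|%:R * p : R.
have m0 : 0 < m by rewrite mulr_gt0 // ltr0n.
have pointwise w : \sum_(o : 'I_1 + F)
      (if o is inr _ then 2 * m else m ^+ 2) *
      \1_(if o is inr f then E f else Z) w <=
    \sum_(o : 'I_1 + F * F) (if o is inr _ then 1 else m ^+ 2) *
      \1_(if o is inr fg then E fg.1 `&` E fg.2 else setT) w.
  rewrite !big_sumType !big_ord1 /= -mulr_sumr indicT mulr1.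
  under [X in _ <= _ + X]eq_bigr do rewrite mul1r indicI /=.
  rewrite -(pair_bigA _ (fun f g => \1_(E f) w * \1_(E g) w)) /=.
  under [X in _ <= _ + X]eq_bigr do rewrite -mulr_sumr.
  rewrite -mulr_suml; set N := \sum_f \1_(E f) w.
  have [Zw|nZw] := pselect (Z w).
    have -> : N = 0 by apply: big1 => f _; rewrite indicE memNset //; exact: Zw.
    by rewrite !mulr0 !addr0 indicE mem_set // mulr1.
  rewrite indicE memNset // mulr0 add0r.
  have := sqr_ge0 (m - N). nra.
have := prob_le_of_indic_le _ _ _ _ pointwise.
rewrite !big_sumType !big_ord1 /= -mulr_sumr probability_setT mulr1.
under [X in _ <= _ + X]eq_bigr do rewrite mul1r.
rewrite -(pair_bigA _ (fun f g => fine (P (E f `&` E g)))) /=.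
rewrite (eq_bigr _ (fun f _ => Ep f)) sumr_const -[p *+ _]mulr_natl -/m.
move=> bound.
have {}bound : m ^+ 2 * fine (P Z) + 2 * m * m <=
    m ^+ 2 + (#|F|%:R * p) ^+ 2 * (1 + s).
  apply: le_trans (lerD (lexx _) Es); apply: bound.
  - by case=> [_|_]; rewrite ?sqr_ge0 // mulr_ge0 // ltW.
  - by case=> [_|_]; rewrite ?sqr_ge0.
  - by case.
  - by case=> [_|[f g]] //=; exact: measurableI.
have m20 : 0 < m ^+ 2 by rewrite exprn_gt0.
by rewrite -(ler_pM2l m20); move: bound; rewrite -/m; nra.
Qed.

End FiniteProbability.

(** The outer measure of [G] is at most [c].  Bounds in this form pass to
    subsets and unions without any measurability proof for the events met on
    the way. *)
Definition outer_prob_le (R : realType) (d : measure_display)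
    (T : measurableType d) (P : probability T R) (G : set T) (c : R) : Prop :=
  exists E, [/\ measurable E, G `<=` E & (P E <= c%:E)%E].

Section OuterProbability.
Context {R : realType} {d : measure_display} {T : measurableType d}
  {P : probability T R}.

Lemma outer_prob_le_measurable (G : set T) (c : R) :
  measurable G -> (P G <= c%:E)%E -> outer_prob_le P G c.
Proof. by move=> mG Gc; exists G; split. Qed.

Lemma prob_le_of_outer (G : set T) (c : R) :
  measurable G -> outer_prob_le P G c -> (P G <= c%:E)%E.
Proof.
by move=> mG [E [mE GE Ec]]; apply: le_trans Ec; apply: le_measure; rewrite ?inE.
Qed.

Lemma outer_prob_leS (G H : set T) (c e : R) :
  G `<=` H -> c <= e -> outer_prob_le P H c -> outer_prob_le P G e.
Proof.
move=> GH ce [E [mE HE Ec]]; exists E; split => //.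
  exact: subset_trans HE.
by apply: le_trans Ec _; rewrite lee_fin.
Qed.

Lemma outer_prob_leU (G H : set T) (c e : R) :
  outer_prob_le P G c -> outer_prob_le P H e ->
  outer_prob_le P (G `|` H) (c + e).
Proof.
move=> [E [mE GE Ec]] [F [mF HF Fe]]; exists (E `|` F); split.
- exact: measurableU.
- exact: setUSS.
by apply: le_trans (measureU2 _ mE mF) _; rewrite EFinD leeD.
Qed.

Lemma outer_prob_le_exists (I : eqType) (r : seq I) (D : pred I)
    (G : I -> set T) (c : I -> R) :
  (forall i, D i -> outer_prob_le P (G i) (c i)) ->
  outer_prob_le P [set w | exists i, [/\ i \in r, D i & G i w]]
    (\sum_(i <- r | D i) c i).
Proof.
move=> Gc; elim: r => [|i r IH].
  exists set0; split; rewrite ?measure0 ?big_nil //.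
  by move=> w [i []].
rewrite big_cons; case: ifPn => Di.
  apply: outer_prob_leS (lexx _) (outer_prob_leU (Gc i Di) IH) => w [j []].
  by rewrite inE => /orP[/eqP-> _|jr Dj] Gj; [left | right; exists j].
apply: outer_prob_leS (lexx _) IH => w [j [+ Dj Gj]].
rewrite inE => /orP[/eqP ji|jr]; last by exists j.
by rewrite -ji Dj in Di.
Qed.

End OuterProbability.

(** * Independence of the entries *)

Definition entry_sd (R : realType) (alpha : R) (n : nat) (i j : 'I_n) : R :=
  if i == j then alpha else 1.

Lemma entry_sd_gt0 (R : realType) (alpha : R) n (i j : 'I_n) :
  0 < alpha -> 0 < entry_sd alpha i j.
Proof. by rewrite /entry_sd; case: ifP. Qed.

Section Ensemble.
Context {R : realType} {n : nat} {d : measure_display} {T : measurableType d}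
  {P : probability T R} {A : 'I_n -> 'I_n -> {RV P >-> R}} {alpha : R}.
Hypothesis ensA : gaussian_symmetric_ensemble alpha A.

Lemma ensemble_prob (J : {set 'I_n * 'I_n}) (B : 'I_n * 'I_n -> set R)
    (p : 'I_n * 'I_n -> R) :
  (forall ij, ij \in J -> (ij.1 <= ij.2)%N) ->
  (forall ij, measurable (B ij)) ->
  (forall ij, ij \in J ->
    normal_prob 0 (entry_sd alpha ij.1 ij.2) (B ij) = (p ij)%:E) ->
  P [set w | forall ij, ij \in J -> B ij (A ij.1 ij.2 w)] =
  (\prod_(ij in J) p ij)%:E.
Proof.
move=> Jle mB Bp; have [_ offd diag indep] := ensA.
rewrite (indep J B) //; last first.
  by apply/fintype.subsetP => ij /Jle; rewrite inE.
rewrite -prodEFin; apply: eq_bigr => -[i j] ijJ /=.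
rewrite -(Bp _ ijJ) /entry_sd /=.
have := Jle _ ijJ; rewrite leq_eqVlt => /orP[/eqP/val_inj /= <-|/= lt_ij].
  by rewrite eqxx; exact: (diag i _ (mB _)).
have -> : (i == j) = false by rewrite -val_eqE ltn_eqF.
exact: (offd i j lt_ij _ (mB _)).
Qed.

End Ensemble.

(** * Energy and increasing lists of indices *)

(** The normalisation by [alpha ^- 2] on the diagonal is division of each entry
    by its standard deviation. *)
Lemma energyE (R : realType) (alpha : R) (k : nat) (U : {set 'I_k})
    (B : 'M[R]_k) :
  energy U (alpha ^+ 2) B =
  \sum_(ij : 'I_k * 'I_k | [&& ij.1 \in U, ij.2 \in U & (ij.1 <= ij.2)%N])
    (B ij.1 ij.2 / entry_sd alpha ij.1 ij.2) ^+ 2.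
Proof.
rewrite -(pair_big_dep (mem U) (fun i j : 'I_k => (j \in U) && (i <= j)%N)
  (fun i j => (B i j / entry_sd alpha i j) ^+ 2)) /=.
rewrite /energy mulr_sumr -big_split /=; apply: eq_bigr => i iU.
rewrite [RHS](bigD1 i) /= ?iU ?leqnn //; congr (_ + _).
  by rewrite /entry_sd eqxx expr_div_n mulrC.
apply: eq_big => [j|j /andP[jU ij]].
  by rewrite -andbA; congr (_ && _); rewrite ltn_neqAle andbC eq_sym.
by rewrite /entry_sd -val_eqE ltn_eqF // divr1.
Qed.

(** Subsets of size [k] are handled as strictly increasing maps from ['I_k].
    Monotonicity matters because only the entries on and above the diagonal
    are independent. *)
Section StrictlyIncreasing.
Context {k n : nat} {f : 'I_k -> 'I_n}.
Hypothesis f_incr : {homo f : i j / (i < j)%N}.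

Lemma incr_inj : injective f.
Proof.
move=> i j fij; apply/val_inj/eqP; rewrite eqn_leq leqNgt [X in _ && X]leqNgt.
by apply/andP; split; apply/negP => /f_incr; rewrite fij ltnn.
Qed.

Lemma incr_leq : {mono f : i j / (i <= j)%N}.
Proof.
move=> i j; case: (leqP i j) => [|ji].
  by rewrite [(i <= j)%N]leq_eqVlt => /orP[/eqP/val_inj ->|/f_incr /ltnW ->]; rewrite ?leqnn.
by apply/negbTE; rewrite -ltnNge; exact: f_incr.
Qed.

Lemma entry_sd_incr (R : realType) (alpha : R) i j :
  entry_sd alpha (f i) (f j) = entry_sd alpha i j.
Proof. by rewrite /entry_sd (inj_eq incr_inj). Qed.

Lemma energy_mxsub (R : realType) (alpha : R) (U : {set 'I_k}) (B : 'M[R]_n) :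
  energy U (alpha ^+ 2) (mxsub f f B) = energy (f @: U) (alpha ^+ 2) B.
Proof.
rewrite !energyE.
pose ff (ij : 'I_k * 'I_k) := (f ij.1, f ij.2).
have ff_inj : injective ff.
  by move=> [i j] [i' j']; rewrite /ff /= => -[/incr_inj-> /incr_inj->].
rewrite [RHS](_ : _ = \sum_(p in [set ff ij | ij in
    [set ij : 'I_k * 'I_k | [&& ij.1 \in U, ij.2 \in U & (ij.1 <= ij.2)%N]]]%SET)
    (B p.1 p.2 / entry_sd alpha p.1 p.2) ^+ 2).
  rewrite big_imset /=; last by move=> ? ? _ _; exact: ff_inj.
  apply: eq_big => [ij|ij _]; first by rewrite inE.
  by rewrite mxE entry_sd_incr.
apply: eq_bigl => -[a b] /=; apply/and3P/imsetP.
  move=> [/imsetP[i iU ->] /imsetP[j jU ->]]; rewrite incr_leq => ij.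
  by exists (i, j) => //; rewrite inE iU jU.
move=> [[i j]]; rewrite inE /= => /and3P[iU jU ij] [-> ->].
by rewrite !imset_f // incr_leq.
Qed.

End StrictlyIncreasing.

Lemma enum_val_incr (n : nat) (S : {set 'I_n}) :
  {homo (@enum_val _ (mem S)) : i j / (i < j)%N}.
Proof.
have sorted_S : sorted ltn [seq val x | x <- enum S].
  rewrite {1}/enum_mem sorted_map; apply: sorted_filter.
    by move=> x y z; exact: ltn_trans.
  by rewrite -sorted_map -enumT val_enum_ord; exact: iota_ltn_sorted.
move=> i j ij; have x0 := enum_val i.
have nv (l : 'I_#|S|) : val (enum_val l) = nth 0%N [seq val x | x <- enum S] l.
  by rewrite (nth_map x0) -?cardE // (enum_val_nth x0).
rewrite !nv; apply: (sorted_ltn_nth ltn_trans) => //; rewrite inE size_map -cardE //.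
Qed.

Section IncreasingFamilies.
Context {R : realType} {n : nat} {d : measure_display} {T : measurableType d}
  {P : probability T R} {A : 'I_n -> 'I_n -> {RV P >-> R}} {alpha : R}.
Hypothesis ensA : gaussian_symmetric_ensemble alpha A.

Lemma ensemble_prob_incr (u : nat) (f : 'I_u -> 'I_n)
    (B : 'I_u -> 'I_u -> set R) (p : 'I_u -> 'I_u -> R) :
  {homo f : i j / (i < j)%N} -> (forall i j, measurable (B i j)) ->
  (forall i j, normal_prob 0 (entry_sd alpha i j) (B i j) = (p i j)%:E) ->
  P [set w | forall i j : 'I_u, (i <= j)%N -> B i j (A (f i) (f j) w)] =
  (\prod_(ij : 'I_u * 'I_u | (ij.1 <= ij.2)%N) p ij.1 ij.2)%:E.
Proof.
move=> f_incr mB Bp.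
pose ff (ij : 'I_u * 'I_u) := (f ij.1, f ij.2).
have ff_inj : injective ff.
  by move=> [i j] [i' j']; rewrite /ff /= => -[/(incr_inj f_incr)-> /(incr_inj f_incr)->].
pose J := [set ff ij | ij in [set ij : 'I_u * 'I_u | (ij.1 <= ij.2)%N]]%SET.
(* Partial inverse of [ff], which turns [B] into a family indexed by pairs of
   rows. *)
pose back (ab : 'I_n * 'I_n) := [pick ij | ff ij == ab].
have backE ij : back (ff ij) = Some ij.
  rewrite /back; case: pickP => [ij' /eqP /ff_inj -> //|/(_ ij)].
  by rewrite eqxx.
have := @ensemble_prob _ _ _ _ _ _ _ ensA J
  (fun ab => if back ab is Some ij then B ij.1 ij.2 else setT)
  (fun ab => if back ab is Some ij then p ij.1 ij.2 else 1).
have JP ab : ab \in J -> exists2 ij : 'I_u * 'I_u, (ij.1 <= ij.2)%N & ab = ff ij.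
  by case/imsetP => ij; rewrite inE => ? ->; exists ij.
rewrite /J big_imset /=; last by move=> ? ? _ _; exact: ff_inj.
rewrite (eq_big (fun ij : 'I_u * 'I_u => (ij.1 <= ij.2)%N)
  (fun ij => p ij.1 ij.2)); last 2 first.
- by move=> ij; rewrite inE.
- by move=> ij _; rewrite backE.
move=> <-.
- congr (P _); apply/seteqP; split => w Bw.
    move=> ab /JP [ij ij_le ->]; rewrite backE /=; exact: Bw.
  move=> i j ij; have := Bw (ff (i, j)); rewrite backE; apply.
  by apply: imset_f; rewrite inE.
- by move=> ab /JP [ij ij_le ->]; rewrite /= incr_leq.
- by move=> ab; case: (back ab).
- by move=> ab /JP [[i j] ij_le ->]; rewrite backE /= -Bp -(entry_sd_incr f_incr).
Qed.

End IncreasingFamilies.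

(** * First moment: no submatrix has too much energy *)

(** Round each [x i] down to a multiple of [eta], capped at [N * eta].  If no
    cap is active the rounding loses at most [eta] per term; if one is, that
    term alone already reaches [s]. *)
Lemma discretize_sum (R : realType) (I : finType) (D : pred I) (x : I -> R)
    (eta s : R) (N : nat) :
  (forall i, 0 <= x i) -> 0 < eta -> 0 <= s -> s <= N%:R * eta ->
  s <= \sum_(i | D i) x i ->
  exists c : {ffun I -> 'I_N.+1},
    (forall i, (c i)%:R * eta <= x i) /\
    s - #|I|%:R * eta <= \sum_(i | D i) (c i)%:R * eta.
Proof.
move=> x0 eta0 s0 sN sx.
have xe0 i : 0 <= x i / eta by rewrite divr_ge0 // ltW.
pose c := [ffun i => inord (minn (Num.truncn (x i / eta)) N) : 'I_N.+1].
have cE i : c i = minn (Num.truncn (x i / eta)) N :> nat.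
  by rewrite ffunE inordK // ltnS geq_minr.
have c_le i : (c i)%:R * eta <= x i.
  rewrite -ler_pdivlMr // cE.
  apply: (@le_trans _ _ (Num.truncn (x i / eta))%:R).
    by rewrite ler_nat geq_minl.
  by have /andP[] := truncn_itv (xe0 i).
exists c; split => //.
have [/existsP [i /andP[Di Ni]]|] :=
    boolP [exists i, D i && (N <= Num.truncn (x i / eta))%N].
  apply: (@le_trans _ _ (N%:R * eta)).
    by apply: le_trans sN; rewrite gerBl mulr_ge0 // ltW.
  rewrite (bigD1 i) //= cE (minn_idPr Ni) lerDl.
  by apply: sumr_ge0 => j _; rewrite mulr_ge0 // ltW.
rewrite negb_exists => /forallP small.
rewrite lerBlDr; apply: le_trans sx _.
apply: (@le_trans _ _ (\sum_(i | D i) ((c i)%:R * eta + eta))).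
  apply: ler_sum => i Di; have := small i; rewrite Di /= -ltnNge => iN.
  rewrite cE (minn_idPl (ltnW iN)) -{3}[eta]mul1r -mulrDl -ler_pdivrMr //.
  rewrite natr1.
  by have /andP[_ /ltW] := truncn_itv (xe0 i).
rewrite big_split /= lerD2l sumr_const -[eta *+ _]mulr_natl.
by rewrite ler_wpM2r ?(ltW eta0) // ler_nat max_card.
Qed.

(** The energy of the submatrix is a sum of squares of independent standard
    Gaussians.  Once the sum is discretized, the event is covered by finitely
    many intersections of independent tail events, whose exponents add up to
    the sum; their number depends on [u] and [delta] only. *)
Lemma energy_tail (R : realType) (alpha : R) (u : nat) (delta : R) :
  0 < alpha -> 0 < delta -> exists C : R, 0 <= C /\
  forall (n : nat) (d : measure_display) (T : measurableType d)
    (P : probability T R) (A : 'I_n -> 'I_n -> {RV P >-> R})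
    (f : 'I_u.+1 -> 'I_n) (L : R),
  gaussian_symmetric_ensemble alpha A -> {homo f : i j / (i < j)%N} -> 0 < L ->
  outer_prob_le P
    [set w | 2 * L * (u.+1%:R + delta) <=
       energy [set: 'I_u.+1]%SET (alpha ^+ 2) (mxsub f f (random_matrix A w))]
    (C * expR (- (L * (u.+1%:R + delta / 2)))).
Proof.
move=> a0 d0; pose I := ('I_u.+1 * 'I_u.+1)%type.
pose D (ij : I) := (ij.1 <= ij.2)%N.
have I0 : 0 < #|{: I}|%:R :> R by rewrite ltr0n card_prod card_ord.
(* The total rounding error [#|I| * eta] is the [delta / 2] that is given up. *)
pose eta : R := delta / 2 / #|{: I}|%:R.
have eta0 : 0 < eta by rewrite !divr_gt0.
pose N := (Num.truncn ((u.+1%:R + delta) / eta)).+1.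
have s0 : 0 <= u.+1%:R + delta by rewrite addr_ge0 // ltW.
have sN : u.+1%:R + delta <= N%:R * eta.
  rewrite -ler_pdivrMr // /N.
  have ge0 : 0 <= (u.+1%:R + delta) / eta by rewrite divr_ge0 // ltW.
  by have /andP[_ /ltW] := truncn_itv ge0.
exists (#|{ffun I -> 'I_N.+1}|%:R * 2 ^+ #|{: I}|); split.
  by rewrite mulr_ge0 // exprn_ge0.
move=> n d T P A f L ensA f_incr L0.
pose Dc (c : {ffun I -> 'I_N.+1}) :=
  u.+1%:R + delta / 2 <= \sum_(ij | D ij) (c ij)%:R * eta.
pose B (c : {ffun I -> 'I_N.+1}) i j : set R :=
  [set x | 2 * L * ((c (i, j))%:R * eta) * entry_sd alpha i j ^+ 2 <= x ^+ 2].
pose F c : set T :=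
  [set w | forall i j : 'I_u.+1, (i <= j)%N -> B c i j (A (f i) (f j) w)].
have F_le c : Dc c -> outer_prob_le P (F c)
    (2 ^+ #|{: I}| * expR (- (L * (u.+1%:R + delta / 2)))).
  move=> cD; apply: outer_prob_le_measurable.
    rewrite (_ : F c = \bigcap_(ij in [set ij : I | D ij])
       A (f ij.1) (f ij.2) @^-1` B c ij.1 ij.2).
      apply: fin_bigcap_measurable => [|ij _]; first exact: finite_finset.
      by apply: measurable_funPTI; exact: measurable_sqr_ge.
    apply/seteqP; split => w Fw; first by move=> [i j]; exact: Fw.
    by move=> i j ij; exact: (Fw (i, j)).
  have sd0 i j : entry_sd alpha i j != 0 by rewrite gt_eqF // entry_sd_gt0.
  pose p i j := fine (normal_prob 0 (entry_sd alpha i j) (B c i j)).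
  have pE i j : normal_prob 0 (entry_sd alpha i j) (B c i j) = (p i j)%:E.
    rewrite fineK //.
    apply: (@fin_num_measure _ _ _ (normal_prob 0 (entry_sd alpha i j))).
    exact: measurable_sqr_ge.
  rewrite (ensemble_prob_incr ensA f_incr _ pE); last first.
    by move=> i j; exact: measurable_sqr_ge.
  rewrite lee_fin.
  apply: (@le_trans _ _ (\prod_(ij | D ij)
      (2 * expR (- (L * ((c ij)%:R * eta)))))).
    apply: ler_prod => -[i j] _; rewrite fine_ge0 /=; last first.
      exact: (@measure_ge0 _ _ _ (normal_prob 0 (entry_sd alpha i j))).
    rewrite -lee_fin -pE; apply: le_trans.
      apply: normal_prob_sqr_ge => //.
      rewrite mulr_ge0 ?sqr_ge0 // mulr_ge0 // ?mulr_ge0 //.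
        exact: ltW.
      exact: ltW.
    rewrite lee_fin ler_pM2l // ler_expR lerN2 -[_ ^+ 2 *+ 2]mulr_natr.
    rewrite le_eqVlt; apply/orP; left; apply/eqP.
    have := sd0 _ i j => sdn0.
    by field.
  rewrite big_split /= prodr_const -expR_sum sumrN -mulr_sumr.
  apply: ler_pM; rewrite ?exprn_ge0 ?expR_ge0 //.
    by apply: ler_weXn2l; rewrite ?max_card // ler1n.
  by rewrite ler_expR lerN2 ler_pM2l.
rewrite (_ : _%:R * _ ^+ _ * _ = \sum_(c : {ffun I -> 'I_N.+1})
    2 ^+ #|{: I}| * expR (- (L * (u.+1%:R + delta / 2)))); last first.
  rewrite sumr_const -mulrA mulr_natl. 
  exact: erefl.
apply: outer_prob_leS (outer_prob_le_exists (index_enum _) F_le); last first.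
  rewrite [leRHS](bigID Dc) /= lerDl; apply: sumr_ge0 => c _.
  by rewrite mulr_ge0 ?exprn_ge0 ?expR_ge0.
move=> w /=; rewrite energyE => energy_big.
pose x (ij : I) := (A (f ij.1) (f ij.2) w / entry_sd alpha ij.1 ij.2) ^+ 2 /
  (2 * L).
have [||c [cx cD]] := @discretize_sum _ _ D x eta _ N _ eta0 s0 sN.
- by move=> ij; rewrite divr_ge0 ?sqr_ge0 // mulr_ge0 // ltW.
- rewrite -mulr_suml ler_pdivlMr ?mulr_gt0 // mulrC; apply: le_trans energy_big _.
  rewrite le_eqVlt; apply/orP; left; apply/eqP; apply: eq_big => ij.
    by rewrite !inE.
  by rewrite !mxE.
exists c; split.
- exact: mem_index_enum.
- apply: le_trans cD; rewrite /eta mulrCA divff ?gt_eqF // mulr1; lra.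
move=> i j ij; have := cx (i, j); rewrite /x /=.
have sd0 := entry_sd_gt0 i j a0.
rewrite ler_pdivlMr ?mulr_gt0 // expr_div_n ler_pdivlMr ?exprn_gt0 //.
by rewrite [_ * (2 * L)]mulrC.
Qed.

Lemma energyZ (R : realType) (alpha c : R) (k : nat) (U : {set 'I_k})
    (B : 'M[R]_k) :
  energy U (alpha ^+ 2) (c *: B) = c ^+ 2 * energy U (alpha ^+ 2) B.
Proof.
rewrite !energyE mulr_sumr; apply: eq_bigr => ij _.
by rewrite mxE -mulrA exprMn.
Qed.

(** This is the map through which [principal_submx] selects rows. *)
Definition list_of_set (n k : nat) (S : {set 'I_n}) (hS : #|S| = k)
  (i : 'I_k) : 'I_n := enum_val (cast_ord (esym hS) i).

Lemma list_of_set_incr n k (S : {set 'I_n}) (hS : #|S| = k) :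
  {homo list_of_set hS : i j / (i < j)%N}.
Proof. by move=> i j ij; exact: enum_val_incr. Qed.

Lemma list_of_set_image n k (S : {set 'I_n}) (hS : #|S| = k) :
  [set list_of_set hS i | i in [set: 'I_k]%SET]%SET = S.
Proof.
apply/finset.setP => a; apply/imsetP/idP => [[i _ ->]|aS].
  exact: enum_valP.
exists (cast_ord hS (enum_rank_in aS a)) => //.
by rewrite /list_of_set cast_ordK enum_rankK_in.
Qed.

Lemma scale_q_sqr (R : realType) (n : nat) : (1 <= n)%N ->
  scale_q R n ^+ 2 = 2 * ln n%:R.
Proof.
by move=> n1; rewrite sqr_sqrtr // mulr_ge0 // ln_ge0 // ler1n.
Qed.

(** Union bound over the lists [f] of [#|U|] rows, not over [S]: the event only
    involves the rows of [S] at the positions in [U], and counting all of [S]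
    would cost [n ^ k] instead of [n ^ #|U|]. *)
Lemma energy_upper_bound (R : realType) (alpha : R) (k : nat) (delta : R) :
  0 < alpha -> 0 < delta -> exists C : R, 0 <= C /\
  forall (n : nat) (d : measure_display) (T : measurableType d)
    (P : probability T R) (A : 'I_n -> 'I_n -> {RV P >-> R}),
  gaussian_symmetric_ensemble alpha A -> (2 <= n)%N ->
  outer_prob_le P
    [set w | exists (S : {set 'I_n}) (hS : #|S| = k) (U : {set 'I_k}),
       U != finset.set0 /\
       #|U|%:R + delta < energy U (alpha ^+ 2)
         ((scale_q R n)^-1 *: principal_submx (random_matrix A w) hS)]
    (C * expR (- (delta / 2 * ln n%:R))).
Proof.
move=> a0 d0.
have /choice [C CP] := fun u => energy_tail u a0 d0.
have C0 u : 0 <= C u by have [] := CP u.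
exists (\sum_(u < k) C u); split; first exact: sumr_ge0.
move=> n d T P A ensA n2.
set L := ln n%:R; have L0 : 0 < L by rewrite ln_gt0 // ltr1n.
have expL : expR L = n%:R by rewrite lnK // posrE ltr0n (ltn_trans _ n2).
pose incr (u : nat) (f : {ffun 'I_u.+1 -> 'I_n}) :=
  [forall i : 'I_u.+1, forall j : 'I_u.+1, (i < j)%N ==> (f i < f j)%N].
pose G (u : nat) (f : {ffun 'I_u.+1 -> 'I_n}) : set T :=
  [set w | 2 * L * (u.+1%:R + delta) <=
    energy [set: 'I_u.+1]%SET (alpha ^+ 2) (mxsub f f (random_matrix A w))].
have Gu (u : 'I_k) : xpredT u -> outer_prob_le P
    [set w | exists f, [/\ f \in index_enum _, @incr u f & G u f w]]
    (C u * expR (- (delta / 2 * L))).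
  move=> _; have Gf (f : {ffun 'I_u.+1 -> 'I_n}) : incr u f ->
      outer_prob_le P (G u f) (C u * expR (- (L * (u.+1%:R + delta / 2)))).
    move=> /forallP f_incr; apply: (CP u).2 => // i j ij.
    by have /forallP/(_ j)/implyP := f_incr i; exact.
  apply: outer_prob_leS (outer_prob_le_exists (index_enum _) Gf) => //.
  rewrite sumr_const.
  apply: (@le_trans _ _ (C u * expR (- (L * (u.+1%:R + delta / 2))) *+
      #|{: {ffun 'I_u.+1 -> 'I_n}}|)).
    by rewrite ler_wpMn2l ?max_card // mulr_ge0 ?expR_ge0.
  rewrite card_ffun !card_ord -mulr_natr natrX -expL -expRM_natl -mulrA -expRD.
  rewrite le_eqVlt; apply/orP; left; apply/eqP; congr (_ * expR _); ring.
rewrite mulr_suml.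
apply: outer_prob_leS (outer_prob_le_exists (index_enum _) Gu) => //.
move=> w /= [S [hS [U [U0 UE]]]].
have Uk : (#|U|.-1 < k)%N.
  by rewrite prednK ?card_gt0 // -[leqRHS]card_ord max_card.
have hU : #|U| = (Ordinal Uk).+1 by rewrite /= prednK // card_gt0.
set u : 'I_k := Ordinal Uk in hU.
pose f := [ffun i => list_of_set hS (list_of_set hU i)].
exists u; split => //; first exact: mem_index_enum.
exists f; split; first exact: mem_index_enum.
  apply/forallP => i; apply/forallP => j; apply/implyP => ij; rewrite !ffunE.
  by do 2!apply: list_of_set_incr.
rewrite /G /=.
have -> : mxsub f f (random_matrix A w) =
    mxsub (list_of_set hU) (list_of_set hU)
      (principal_submx (random_matrix A w) hS).
  by apply/matrixP => i j; rewrite !mxE !ffunE.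
rewrite energy_mxsub; last exact: list_of_set_incr.
rewrite list_of_set_image.
move: UE; rewrite energyZ exprVn scale_q_sqr ?(ltnW n2) // -/L hU.
by rewrite mulrC ltr_pdivlMr ?mulr_gt0 // mulrC => /ltW.
Qed.

(** * Second moment over transversals of blocks *)

(** Both maps enumerate their common image in increasing order. *)
Lemma incr_image_inj (k n : nat) (f g : 'I_k -> 'I_n) :
  {homo f : i j / (i < j)%N} -> {homo g : i j / (i < j)%N} ->
  [set f i | i in [set: 'I_k]%SET]%SET = [set g i | i in [set: 'I_k]%SET]%SET ->
  f =1 g.
Proof.
move=> f_incr g_incr fg.
have sorted_vals (h : 'I_k -> 'I_n) : {homo h : i j / (i < j)%N} ->
    sorted ltn [seq val (h i) | i <- enum 'I_k].
  move=> h_incr; rewrite sorted_map.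
  apply: (@sub_sorted _ (fun i j : 'I_k => (i < j)%N)).
    by move=> i j; exact: h_incr.
  by have := iota_ltn_sorted 0 k; rewrite -val_enum_ord sorted_map.
have /eq_in_map E : [seq val (f i) | i <- enum 'I_k] =
    [seq val (g i) | i <- enum 'I_k].
  apply: (irr_sorted_eq ltn_trans ltnn) => [||x]; [exact: sorted_vals.. |].
  move/finset.setP: fg => fg.
  apply/mapP/mapP => -[i _ ->].
    have := fg (f i); rewrite imset_f ?inE // => /esym/imsetP[j _ ->].
    by exists j; rewrite ?mem_enum.
  have := fg (g i); rewrite [RHS]imset_f ?inE // => /imsetP[j _ ->].
  by exists j; rewrite ?mem_enum.
by move=> i; apply/val_inj/E; rewrite mem_enum.
Qed.

Lemma principal_submx_incr (R : realType) (k n : nat) (f : 'I_k -> 'I_n) :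
  {homo f : i j / (i < j)%N} ->
  exists (S : {set 'I_n}) (hS : #|S| = k),
    forall M : 'M[R]_n, principal_submx M hS = mxsub f f M.
Proof.
move=> f_incr; pose S := [set f i | i in [set: 'I_k]%SET]%SET.
have hS : #|S| = k.
  by rewrite card_imset ?cardsT ?card_ord //; exact: incr_inj.
exists S, hS => M; apply/matrixP => i j; rewrite !mxE.
have E : list_of_set hS =1 f.
  apply: incr_image_inj => //; first exact: list_of_set_incr.
  exact: list_of_set_image.
by rewrite -!E.
Qed.

Lemma prod_setUI (R : comRingType) (I : finType) (p : I -> R) (X Y : {set I}) :
  (\prod_(i in X :|: Y) p i) * (\prod_(i in X :&: Y) p i) =
  (\prod_(i in X) p i) * (\prod_(i in Y) p i).
Proof.
rewrite [\prod_(i in X :|: Y) p i](big_setID X) /=.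
rewrite [\prod_(i in Y) p i](big_setID X) /=.
rewrite finset.setUK finset.setDUl finset.setDv finset.set0U.
by rewrite [(Y :&: X)%SET]finset.setIC -mulrA; congr (_ * _); rewrite mulrC.
Qed.

Lemma card_ffun_agree (k m : nat) (f : {ffun 'I_k -> 'I_m}) (U : {set 'I_k}) :
  #|[pred g : {ffun 'I_k -> 'I_m} | [forall (i | i \in U), f i == g i]]| =
  (m ^ (k - #|U|))%N.
Proof.
pose Q i : pred 'I_m := [pred x | (i \in U) ==> (f i == x)].
have -> : #|[pred g : {ffun 'I_k -> 'I_m} | [forall (i | i \in U), f i == g i]]| =
    #|family Q|.
  by apply: eq_card => g; rewrite !inE; apply/forallP/forallP => h i; exact: (h i).
have -> : #|family Q| = (\prod_(i < k) \sum_(j in Q i) 1)%N.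
  rewrite bigA_distr_big_dep -sum1_card; apply: eq_bigr => g _.
  by rewrite big1.
rewrite (bigID (mem U)) /= big1 ?mul1n => [|i iU]; last first.
  rewrite (eq_bigl (pred1 (f i))) ?big_pred1_eq // => x.
  by rewrite unfold_in /= iU eq_sym.
rewrite (eq_bigr (fun=> m)) => [|i iU]; last first.
  rewrite (eq_bigl xpredT) ?sum1_card ?card_ord // => x.
  by rewrite unfold_in /= (negbTE iU).
have UC : (#|U| + #|[predC U]|)%N = k by rewrite cardC card_ord.
rewrite prod_nat_const; congr (m ^ _)%N.
have <- : (#|U| + #|[predC U]| - #|U|)%N = (k - #|U|)%N by rewrite UC.
by rewrite addKn.
Qed.

(** Block number [i] is made of the [m] rows from [i * m] on; the rows from
    [k * m] on are in no block.  A choice of one row per block is automatically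
    increasing, and the block of a row tells its position in the list. *)
Section Blocks.
Context {n k m : nat}.
Hypothesis km_n : (k * m <= n)%N.

Lemma block_index_subproof (i : 'I_k) (x : 'I_m) : (i * m + x < n)%N.
Proof.
apply: leq_trans km_n; apply: (@leq_trans (i.+1 * m)).
  by rewrite mulSnr ltn_add2l.
by rewrite leq_mul2r ltn_ord orbT.
Qed.

Definition block_index (i : 'I_k) (x : 'I_m) : 'I_n :=
  Ordinal (block_index_subproof i x).

Definition block_of (a : 'I_n) : option 'I_k := insub (a %/ m)%N.

Lemma block_indexK i x : block_of (block_index i x) = Some i.
Proof.
have m0 : (0 < m)%N by apply: leq_ltn_trans (ltn_ord x).
rewrite /block_of /= divnMDl // divn_small // addn0.
by rewrite insubT // => lt_i; congr Some; exact: val_inj.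
Qed.

Lemma block_index_inj i : injective (block_index i).
Proof. by move=> x y [/addnI]/val_inj. Qed.

Lemma block_index_incr (f : 'I_k -> 'I_m) :
  {homo (fun i => block_index i (f i)) : i j / (i < j)%N}.
Proof.
move=> i j ij /=; apply: (@leq_trans (i.+1 * m)).
  by rewrite mulSnr ltn_add2l.
by apply: leq_trans (leq_addr _ _); rewrite leq_mul2r ij orbT.
Qed.

End Blocks.

(** [B i j] is the set of allowed values for the entry at position [(i, j)], and
    [E f] below is the event that all entries on and above the diagonal
    of the submatrix carried by the transversal [f] are allowed. *)
Section SecondMoment.
Context {R : realType} {n : nat} {d : measure_display} {T : measurableType d}
  {P : probability T R} {A : 'I_n -> 'I_n -> {RV P >-> R}} {alpha : R}.
Hypothesis ensA : gaussian_symmetric_ensemble alpha A.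
Context {k m : nat}.
Hypotheses (km_n : (k * m <= n)%N) (m_gt0 : (0 < m)%N).
Context {B : 'I_k -> 'I_k -> set R} {p : 'I_k -> 'I_k -> R}.
Hypothesis measB : forall i j, measurable (B i j).
Hypothesis probB : forall i j,
  normal_prob 0 (entry_sd alpha i j) (B i j) = (p i j)%:E.
Hypothesis p_gt0 : forall i j, 0 < p i j.

Let on (U : {set 'I_k}) : {set 'I_k * 'I_k} :=
  [set ij | [&& ij.1 \in U, ij.2 \in U & (ij.1 <= ij.2)%N]]%SET.

Let pU (U : {set 'I_k}) : R := \prod_(ij in on U) p ij.1 ij.2.

Let pU_gt0 U : 0 < pU U.
Proof. exact: prodr_gt0. Qed.

Let pos (f : {ffun 'I_k -> 'I_m}) (i : 'I_k) : 'I_n :=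
  block_index km_n i (f i).

Let pairs (f : {ffun 'I_k -> 'I_m}) (U : {set 'I_k}) : {set 'I_n * 'I_n} :=
  [set (pos f ij.1, pos f ij.2) | ij in on U]%SET.

Let blk (a : 'I_n) : option 'I_k := @block_of n k m a.

(* The constraint on an entry depends only on the blocks of its row and column,
   hence not on the transversal that uses it. *)
Let B' (ab : 'I_n * 'I_n) : set R :=
  if (blk ab.1, blk ab.2) is (Some i, Some j) then B i j else setT.

Let p' (ab : 'I_n * 'I_n) : R :=
  if (blk ab.1, blk ab.2) is (Some i, Some j) then p i j else 1.

Let E (f : {ffun 'I_k -> 'I_m}) : set T :=
  [set w | forall ab, ab \in pairs f [set: 'I_k]%SET -> B' ab (A ab.1 ab.2 w)].

Let agree (f g : {ffun 'I_k -> 'I_m}) : {set 'I_k} :=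
  [set i | f i == g i]%SET.

Let block_pos f i : blk (pos f i) = Some i :> option 'I_k.
Proof. exact: block_indexK. Qed.

Let pos_incr f : {homo pos f : i j / (i < j)%N}.
Proof. exact: block_index_incr. Qed.

Let B'_pos f g i j : B' (pos f i, pos g j) = B i j.
Proof. by rewrite /B' /= !block_pos. Qed.

Let prod_pairs f U : \prod_(ab in pairs f U) p' ab = pU U.
Proof.
rewrite /pairs big_imset /=; last first.
  move=> [i j] [i' j'] _ _ /= /pair_equal_spec[].
  by move=> /(incr_inj (@pos_incr f)) -> /(incr_inj (@pos_incr f)) ->.
by apply: eq_bigr => ij _; rewrite /p' /= !block_pos.
Qed.

(* Equal rows lie in the same block, so a shared entry has the same position in
   both transversals. *)
Let pairsI f g :
  (pairs f [set: 'I_k]%SET :&: pairs g [set: 'I_k]%SET)%SET =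
  pairs f (agree f g).
Proof.
apply/finset.setP => ab; rewrite finset.in_setI; apply/andP/imsetP.
  move=> [/imsetP[[i j] ij ->] /imsetP[[i' j'] _ /= /pair_equal_spec[ei ej]]].
  have ii' : i = i' by apply: Some_inj; rewrite -(block_pos f) -(block_pos g) ei.
  have jj' : j = j' by apply: Some_inj; rewrite -(block_pos f) -(block_pos g) ej.
  exists (i, j) => //; move: ij; rewrite !inE /= => ->.
  rewrite andbT; apply/andP; split; apply/eqP.
    by apply: (@block_index_inj _ _ _ km_n i); move: ei; rewrite -ii'.
  by apply: (@block_index_inj _ _ _ km_n j); move: ej; rewrite -jj'.
move=> [[i j]]; rewrite !inE /= => /and3P[/eqP fi /eqP fj ij] ->; split.
  by apply/imsetP; exists (i, j); rewrite ?inE.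
by apply/imsetP; exists (i, j); rewrite ?inE //= /pos fi fj.
Qed.

Let prob_pairs (J : {set 'I_n * 'I_n}) :
  (forall ab, ab \in J -> exists f, ab \in pairs f [set: 'I_k]%SET) ->
  P [set w | forall ab, ab \in J -> B' ab (A ab.1 ab.2 w)] =
  (\prod_(ab in J) p' ab)%:E.
Proof.
move=> Jpairs; apply: (ensemble_prob ensA).
- move=> ab /Jpairs[f /imsetP[[i j]]]; rewrite !inE /= => ij ->.
  exact: (etrans (incr_leq (@pos_incr f) i j) ij).
- by move=> ab; rewrite /B'; case: blk => // i; case: blk.
move=> ab /Jpairs[f /imsetP[[i j] _ -> /=]].
by rewrite B'_pos /p' /= !block_pos -probB -(entry_sd_incr (@pos_incr f)).
Qed.

Let measE f : measurable (E f).
Proof.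
rewrite (_ : E f = \bigcap_(ab in [set ab | ab \in pairs f [set: 'I_k]%SET])
    A ab.1 ab.2 @^-1` B' ab).
  apply: fin_bigcap_measurable => [|ab _]; first exact: finite_finset.
  apply: measurable_funPTI.
  by rewrite /B'; case: blk => // i; case: blk.
by apply/seteqP; split.
Qed.

Let probE f : fine (P (E f)) = pU [set: 'I_k]%SET.
Proof. by rewrite prob_pairs ?prod_pairs // => ab; exists f. Qed.

(* The entries shared by [f] and [g] are counted once in the intersection but
   twice in the product of the two probabilities. *)
Let probEI f g :
  fine (P (E f `&` E g)) = pU [set: 'I_k]%SET ^+ 2 / pU (agree f g).
Proof.
have -> : E f `&` E g =
    [set w | forall ab, ab \in (pairs f [set: 'I_k]%SET :|: pairs g [set: 'I_k]%SET)%SET ->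
       B' ab (A ab.1 ab.2 w)].
  apply/seteqP; split => w.
    move=> [Ef Eg] ab; rewrite finset.in_setU => /orP[]; [exact: Ef|exact: Eg].
  by move=> EU; split => ab ab_in; apply: EU; rewrite finset.in_setU ab_in ?orbT.
rewrite prob_pairs; last first.
  by move=> ab; rewrite finset.in_setU => /orP[]; [exists f|exists g].
rewrite -(prod_pairs f (agree f g)) -pairsI /= expr2.
rewrite -{1}(prod_pairs f) -(prod_pairs g) -prod_setUI mulfK //.
by rewrite pairsI prod_pairs gt_eqF.
Qed.

(* Summing over all [U] on which [f] and [g] agree, instead of the largest one,
   only adds nonnegative terms and leaves [m ^ (k - #|U|)] maps to count; the
   term of the empty set is the 1. *)
Let sum_agree f : \sum_g (pU (agree f g))^-1 <=
  m%:R ^+ k * (1 + \sum_(U : {set 'I_k} | U != finset.set0)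
                     (m%:R ^+ #|U| * pU U)^-1).
Proof.
apply: (@le_trans _ _ (\sum_(U : {set 'I_k})
    \sum_(g : {ffun 'I_k -> 'I_m} | [forall (i | i \in U), f i == g i])
      (pU U)^-1)).
  rewrite (exchange_big_dep xpredT) //=; apply: ler_sum => g _.
  rewrite (bigD1 (agree f g)) /=.
    by rewrite lerDl sumr_ge0 // => U _; rewrite invr_ge0 ltW.
  by apply/forallP => i; rewrite inE; apply/implyP.
have m0 : m%:R != 0 :> R by rewrite pnatr_eq0 -lt0n.
have countU (U : {set 'I_k}) :
    \sum_(g : {ffun 'I_k -> 'I_m} | [forall (i | i \in U), f i == g i])
      (pU U)^-1 = m%:R ^+ k * (m%:R ^+ #|U| * pU U)^-1.
  rewrite sumr_const (card_ffun_agree f U) -[LHS]mulr_natl natrX.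
  rewrite invfM mulrA; congr (_ * _).
  have Uk : (#|U| <= k)%N by rewrite -[leqRHS]card_ord max_card.
  have <- : m%:R ^+ (k - #|U|) * m%:R ^+ #|U| = m%:R ^+ k :> R.
    by rewrite -exprD subnK.
  by rewrite mulfK // expf_neq0.
rewrite (eq_bigr _ (fun U _ => countU U)) -mulr_sumr.
rewrite (bigD1 finset.set0) //= cards0 expr0 mul1r.
rewrite (_ : pU finset.set0 = 1) ?invr1 //.
by apply: big1 => ij; rewrite !inE.
Qed.

(** The term of [U] in the sum is the inverse of the mean number of row choices
    in [U] that meet the constraints indexed by [U]: transversals fail to hit
    only if one of these means is small. *)
Lemma no_hit_prob :
  outer_prob_le P
    [set w | ~ exists (S : {set 'I_n}) (hS : #|S| = k), forall i j : 'I_k,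
       (i <= j)%N -> B i j (principal_submx (random_matrix A w) hS i j)]
    (\sum_(U : {set 'I_k} | U != finset.set0)
      (m%:R ^+ #|U| *
       \prod_(ij : 'I_k * 'I_k | [&& ij.1 \in U, ij.2 \in U & (ij.1 <= ij.2)%N])
         p ij.1 ij.2)^-1).
Proof.
set s := (X in outer_prob_le _ _ X).
pose Z := [set w | forall f, ~ E f w].
have sE : s = \sum_(U : {set 'I_k} | U != finset.set0) (m%:R ^+ #|U| * pU U)^-1.
  apply: eq_bigr => U _; congr (_ * _)^-1.
  by apply: eq_bigl => ij; rewrite inE.
have mZ : measurable Z.
  rewrite (_ : Z = \bigcap_(f in [set: {ffun 'I_k -> 'I_m}]) ~` E f).
    by apply: fin_bigcap_measurable => // f _; exact: measurableC.
  by apply/seteqP; split => w Zw f; [move=> _; exact: Zw | exact: Zw].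
have F0 : (0 < #|{: {ffun 'I_k -> 'I_m}}|)%N.
  by rewrite card_ffun !card_ord expn_gt0 m_gt0.
apply: (@outer_prob_leS _ _ _ _ _ Z s s) => //.
  move=> w noS f Ef; apply: noS.
  have [S [hS SM]] := principal_submx_incr R (@pos_incr f).
  exists S, hS => i j ij; rewrite SM !mxE -(B'_pos f f).
  by apply: (Ef (pos f i, pos f j)); apply/imsetP; exists (i, j); rewrite ?inE.
apply: outer_prob_le_measurable => //.
rewrite -[X in (X <= _)%E]fineK ?fin_num_measure // lee_fin.
apply: (second_moment_bound (E := E) (p := pU [set: 'I_k]%SET)) => //.
rewrite (eq_bigr _ (fun f _ => eq_bigr _ (fun g _ => probEI f g))).
under eq_bigr => f _ do rewrite -mulr_sumr.
rewrite -mulr_sumr exprMn [leRHS]mulrAC [leRHS]mulrC.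
rewrite ler_wpM2l ?sqr_ge0 //.
apply: le_trans (ler_sum _ (fun f _ => sum_agree f)) _.
rewrite sumr_const -sE -[leLHS]mulr_natl card_ffun !card_ord natrX.
by rewrite mulrA expr2.
Qed.

End SecondMoment.

(** * Lower bound: contracted points of the body are approximated *)

(** Contracting by [1 - eta] leaves room [eta * #|U|] in every constraint, part
    of which pays for enlarging the entries by [r].  By convexity of the square,
    [((1 - eta) * x + eta * (r / eta)) ^+ 2] is at most
    [(1 - eta) * x ^+ 2 + r ^+ 2 / eta]. *)
Lemma energy_bound_nearby (R : realType) (alpha eta r : R) (k : nat)
    (U : {set 'I_k}) (y : 'M[R]_k) :
  0 < alpha -> 0 < eta <= 1 -> 0 <= r ->
  k%:R ^+ 2 * (1 + alpha ^- 2) * r ^+ 2 <= eta ^+ 2 / 2 ->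
  U != finset.set0 -> energy U (alpha ^+ 2) y <= #|U|%:R ->
  \sum_(ij : 'I_k * 'I_k | [&& ij.1 \in U, ij.2 \in U & (ij.1 <= ij.2)%N])
    (((1 - eta) * `|y ij.1 ij.2| + r) / entry_sd alpha ij.1 ij.2) ^+ 2
  <= #|U|%:R - eta / 2.
Proof.
move=> a0 /andP[eta0 eta1] r0 small U0 yU.
have sd_inv (i j : 'I_k) : entry_sd alpha i j ^- 2 <= 1 + alpha ^- 2.
  rewrite /entry_sd; case: ifP => _; first by rewrite lerDr.
  by rewrite expr1n invr1 lerDl invr_ge0 exprn_ge0 // ltW.
pose e : R := r ^+ 2 / eta * (1 + alpha ^- 2).
have e0 : 0 <= e.
  by rewrite mulr_ge0 ?divr_ge0 ?sqr_ge0 ?addr_ge0 ?invr_ge0 ?sqr_ge0 // ltW.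
apply: (@le_trans _ _ (\sum_(ij : 'I_k * 'I_k |
    [&& ij.1 \in U, ij.2 \in U & (ij.1 <= ij.2)%N])
    ((1 - eta) * (y ij.1 ij.2 / entry_sd alpha ij.1 ij.2) ^+ 2 + e))).
  apply: ler_sum => -[i j] _ /=; set s := entry_sd _ _ _.
  rewrite !expr_div_n.
  have convex : ((1 - eta) * `|y i j| + r) ^+ 2 <=
      (1 - eta) * y i j ^+ 2 + r ^+ 2 / eta.
    rewrite -[y i j ^+ 2]real_normK ?num_real //; set x := `|y i j|.
    have -> : (1 - eta) * x ^+ 2 + r ^+ 2 / eta =
       ((1 - eta) * x + r) ^+ 2 + (1 - eta) / eta * (eta * x - r) ^+ 2.
      by field; rewrite gt_eqF.
    rewrite lerDl mulr_ge0 ?sqr_ge0 // divr_ge0 ?subr_ge0 //; exact: ltW.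
  apply: (@le_trans _ _ (((1 - eta) * y i j ^+ 2 + r ^+ 2 / eta) / s ^+ 2)).
    by rewrite ler_wpM2r // invr_ge0 sqr_ge0.
  rewrite mulrDl -mulrA lerD2l /e; apply: ler_wpM2l; last exact: sd_inv.
  by rewrite divr_ge0 ?sqr_ge0 // ltW.
rewrite big_split /= -mulr_sumr -energyE sumr_const.
have U1 : 1 <= #|U|%:R :> R by rewrite ler1n card_gt0.
have eta_e : k%:R ^+ 2 * e <= eta / 2.
  rewrite /e [r ^+ 2 / eta * _]mulrAC !mulrA ler_pdivrMr //.
  apply: le_trans (le_trans small _); first by rewrite [leRHS]mulrAC mulrA.
  by rewrite expr2 mulrAC.
have card_e : e *+ #|[pred ij : 'I_k * 'I_k |
    [&& ij.1 \in U, ij.2 \in U & (ij.1 <= ij.2)%N]]| <= k%:R ^+ 2 * e.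
  rewrite -[leLHS]mulr_natl ler_wpM2r // -natrX ler_nat.
  by apply: leq_trans (max_card _) _; rewrite card_prod card_ord.
have : (1 - eta) * energy U (alpha ^+ 2) y <= (1 - eta) * #|U|%:R.
  by rewrite ler_wpM2l // subr_ge0.
move: card_e eta_e; rewrite -sumr_const /= sumr_const.
set E := energy _ _ _; set S := _ *+ _; nra.
Qed.

Lemma normal_peak_entry_gt0 (R : realType) (alpha : R) : 0 < alpha ->
  exists2 c : R, 0 < c &
    forall k (i j : 'I_k), c <= normal_peak (entry_sd alpha i j).
Proof.
move=> a0; exists (Num.min (normal_peak alpha) (normal_peak 1)).
  by rewrite lt_min !normal_peak_gt0 // gt_eqF.
by move=> k i j; rewrite /entry_sd ge_min; case: ifP; rewrite lexx ?orbT.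
Qed.

(** The target for the rescaled entries is the box of radius [r] around
    [(1 - eta) *: y].  The constant [C] does not depend on [y], which allows a
    union over a net. *)
Lemma approximation_bound (R : realType) (alpha eta delta : R) (k : nat) :
  (1 <= k)%N -> 0 < alpha -> 0 < eta <= 1 -> 0 < delta ->
  exists C : R, 0 <= C /\
  forall (n : nat) (d : measure_display) (T : measurableType d)
    (P : probability T R) (A : 'I_n -> 'I_n -> {RV P >-> R}) (y : 'M[R]_k),
  gaussian_symmetric_ensemble alpha A -> (k <= n)%N -> 1 <= ln n%:R :> R ->
  limit_body (alpha ^+ 2) y ->
  outer_prob_le P
    [set w | ~ exists (S : {set 'I_n}) (hS : #|S| = k), forall i j,
       `|((scale_q R n)^-1 *: principal_submx (random_matrix A w) hS) i j
         - (1 - eta) * y i j| <= delta]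
    (C * expR (- (eta / 2 * ln n%:R))).
Proof.
move=> k1 a0 eta01 d0; have /andP[eta0 eta1] := eta01.
pose kappa : R := k%:R ^+ 2 * (1 + alpha ^- 2).
have kappa1 : 1 <= kappa.
  rewrite -[leLHS]mulr1 ler_pM //; first by rewrite -natrX ler1n expn_gt0 k1.
  by rewrite lerDl invr_ge0 exprn_ge0 // ltW.
have kappa0 : 0 < kappa := lt_le_trans ltr01 kappa1.
(* Enlarging the entries by [r] costs at most half of the room [eta] left by the
   contraction. *)
pose r := Num.min delta (eta / (2 * kappa)).
have r0 : 0 < r by rewrite lt_min d0 divr_gt0 // mulr_gt0.
have r_small : kappa * r ^+ 2 <= eta ^+ 2 / 2.
  have r_le : r <= eta / (2 * kappa) by rewrite ge_min lexx orbT.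
  have rk : r * (2 * kappa) <= eta by rewrite -ler_pdivlMr // mulr_gt0.
  have r_eta : r <= eta by apply: le_trans rk; rewrite ler_peMr ?(ltW r0) //; lra.
  have -> : kappa * r ^+ 2 = r * (r * (2 * kappa)) / 2 by field.
  rewrite ler_pM2r ?invr_gt0 // expr2; apply: ler_pM => //; first exact: ltW.
  by rewrite mulr_ge0 ?(ltW r0) // mulr_ge0 // ltW.
have [c0 c00 c0_le] := normal_peak_entry_gt0 a0.
pose c := Num.min 1 (2 * r * c0).
have c_gt0 : 0 < c by rewrite lt_min ltr01 !mulr_gt0.
have c_le1 : c <= 1 by rewrite ge_min lexx.
pose D : R := c ^+ (k * k) / (2 * k)%:R ^+ k.
have k2 : 0 < (2 * k)%:R :> R by rewrite ltr0n muln_gt0.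
have D0 : 0 < D by rewrite divr_gt0 // exprn_gt0.
exists (#|{: {set 'I_k}}|%:R / D); split; first by rewrite divr_ge0 // ltW.
move=> n d T P A y ensA kn L1 [ysym yK].
set L := ln n%:R in L1 *; set q := scale_q R n.
have n_gt0 : (0 < n)%N := leq_trans k1 kn.
have q2 : q ^+ 2 = 2 * L by exact: scale_q_sqr.
have q1 : 1 <= q.
  rewrite -(@ler_pXn2r _ 2) ?nnegrE ?sqrtr_ge0 // q2 expr1n.
  by rewrite (le_trans L1) // ler_peMl ?(le_trans ler01) // ler1n.
have q0 : 0 < q := lt_le_trans ltr01 q1.
have expL : expR L = n%:R by rewrite lnK // posrE ltr0n.
(* [m] is comparable to [n]: this costs the factor [(2 * k) ^ k] in [D]. *)
pose m := (n %/ k)%N.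
have m_gt0 : (0 < m)%N by rewrite divn_gt0.
have km_n : (k * m <= n)%N by rewrite mulnC leq_divM.
have n_le : (n <= 2 * k * m)%N.
  rewrite {1}(divn_eq n k) -/m mul2n -addnn mulnDl [(m * k)%N]mulnC leq_add2l.
  by apply: leq_trans (ltnW (ltn_pmod n k1)) _; rewrite leq_pmulr.
pose B i j : set R := [set x | `|x - q * ((1 - eta) * y i j)| <= q * r].
have measB i j : measurable (B i j) by exact: measurable_dist_le.
pose p i j := fine (normal_prob 0 (entry_sd alpha i j) (B i j)).
have pE i j : normal_prob 0 (entry_sd alpha i j) (B i j) = (p i j)%:E.
  rewrite fineK //.
  apply: (@fin_num_measure _ _ _ (normal_prob 0 (entry_sd alpha i j))).
  exact: measB.
have sd0 (i j : 'I_k) := entry_sd_gt0 i j a0.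
pose e i j : R := (((1 - eta) * `|y i j| + r) / entry_sd alpha i j) ^+ 2.
have p_ge i j : c * expR (- (L * e i j)) <= p i j.
  rewrite -lee_fin -pE; apply: le_trans; last first.
    by apply: normal_prob_near_ge; rewrite ?gt_eqF // mulr_gt0.
  rewrite lee_fin; apply: ler_pM; rewrite ?expR_ge0 ?(ltW c_gt0) //.
    rewrite ge_min; apply/orP; right.
    rewrite -!mulrA ler_pM2l // mulrA.
    apply: ler_pM; rewrite ?(ltW r0) ?(ltW c00) //.
    by rewrite ler_peMl // ltW.
  rewrite ler_expR lerN2 /e !normrM (gtr0_norm q0) ger0_norm ?subr_ge0 //.
  rewrite -mulrDr exprMn q2 expr_div_n -[_ ^+ 2 *+ 2]mulr_natr.
  rewrite le_eqVlt; apply/orP; left; apply/eqP.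
  by have := sd0 i j => sd_gt0; field; rewrite gt_eqF.
have p_gt0 i j : 0 < p i j.
  by apply: lt_le_trans (p_ge i j); rewrite mulr_gt0 // expR_gt0.
apply: outer_prob_leS (no_hit_prob ensA km_n m_gt0 measB pE p_gt0).
  move=> w far [S [hS near]]; apply: far; exists S, hS.
  have [symA _ _ _] := ensA.
  have near_le (i j : 'I_k) : (i <= j)%N ->
     `|(q^-1 *: principal_submx (random_matrix A w) hS) i j
         - (1 - eta) * y i j| <= delta.
    move=> ij; have := near i j ij; rewrite /B /= => h.
    apply: (@le_trans _ _ r); last by rewrite ge_min lexx.
    rewrite -(ler_pM2l q0); apply: le_trans h.
    rewrite -{1}(gtr0_norm q0) -normrM mulrBr mxE mulrA divff ?gt_eqF //.
    by rewrite mul1r.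
  move=> i j; have [/near_le //|ji] := leqP i j.
  have := near_le j i (ltnW ji); congr (`|_ - _| <= _).
    by rewrite !mxE symA.
  by rewrite -[in RHS]ysym mxE.
apply: (@le_trans _ _ (\sum_(U : {set 'I_k} | U != finset.set0)
    D^-1 * expR (- (eta / 2 * L)))).
  apply: ler_sum => U U0.
  rewrite expRN -invfM lef_pV2 ?posrE; last 2 first.
  - by rewrite mulr_gt0 ?exprn_gt0 ?ltr0n // prodr_gt0.
  - by rewrite mulr_gt0 // expR_gt0.
  have prod_ge : c ^+ (k * k) * expR (- (L * (#|U|%:R - eta / 2))) <=
    \prod_(ij : 'I_k * 'I_k | [&& ij.1 \in U, ij.2 \in U & (ij.1 <= ij.2)%N])
       p ij.1 ij.2.
    apply: (@le_trans _ _ (\prod_(ij : 'I_k * 'I_k |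
        [&& ij.1 \in U, ij.2 \in U & (ij.1 <= ij.2)%N])
        (c * expR (- (L * e ij.1 ij.2))))); last first.
      apply: ler_prod => ij _; rewrite p_ge andbT.
      by rewrite mulr_ge0 ?expR_ge0 // ltW.
    rewrite big_split /= prodr_const -expR_sum sumrN -mulr_sumr.
    apply: ler_pM; rewrite ?expR_ge0 ?exprn_ge0 ?(ltW c_gt0) //.
      apply: ler_wiXn2l => //; first exact: ltW.
      by apply: leq_trans (max_card _) _; rewrite card_prod card_ord.
    rewrite ler_expR lerN2. apply: ler_wpM2l; first exact: le_trans L1.
    by apply: energy_bound_nearby => //; [exact: ltW | exact: yK].
  have m_ge : expR (#|U|%:R * L) / (2 * k)%:R ^+ k <= m%:R ^+ #|U|.
    rewrite expRM_natl expL ler_pdivrMr ?exprn_gt0 //.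
    apply: (@le_trans _ _ (m%:R ^+ #|U| * (2 * k)%:R ^+ #|U|)).
      rewrite -exprMn; apply: lerXn2r; rewrite ?nnegrE ?mulr_ge0 //.
      by rewrite -natrM ler_nat mulnC.
    rewrite ler_wpM2l ?exprn_ge0 // ler_weXn2l //.
      by rewrite ler1n muln_gt0.
    by rewrite -[leqRHS]card_ord max_card.
  apply: le_trans; last first.
    apply: ler_pM m_ge prod_ge; rewrite ?mulr_ge0 ?divr_ge0 ?expR_ge0 ?exprn_ge0 //.
    exact: ltW.
  rewrite le_eqVlt; apply/orP; left; apply/eqP.
  have -> : expR (eta / 2 * L) =
      expR (#|U|%:R * L) * expR (- (L * (#|U|%:R - eta / 2))).
    by rewrite -expRD; congr expR; ring.
  rewrite /D; ring.
rewrite sumr_const -[leRHS]mulrA -[leLHS]mulr_natl.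
apply: ler_wpM2r; last by rewrite ler_nat max_card.
by rewrite mulr_ge0 ?expR_ge0 // invr_ge0 ltW.
Qed.

(** * The limit body *)

Section LimitBody.
Context {R : realType} {k : nat} {alpha : R}.
Hypothesis alpha_gt0 : 0 < alpha.
Local Notation body := (@limit_body R k (alpha ^+ 2)).

Lemma limit_body0 : body 0.
Proof.
split=> [|U _]; first by rewrite trmx0.
rewrite energyE big1 // => ij _.
by rewrite mxE mul0r expr0n.
Qed.

Lemma limit_body_entry_le (y : 'M[R]_k) (i j : 'I_k) :
  body y -> `|y i j| <= 1 + k%:R * (1 + alpha ^+ 2).
Proof.
move=> [ysym yK].
have entry_le (i' j' : 'I_k) : (i' <= j')%N ->
    `|y i' j'| <= 1 + k%:R * (1 + alpha ^+ 2).
  move=> ij; have sd_gt0 := entry_sd_gt0 i' j' alpha_gt0.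
  have T0 : [set: 'I_k]%SET != finset.set0.
    by apply/finset.set0Pn; exists i'; rewrite inE.
  have := yK _ T0; rewrite energyE cardsT card_ord.
  rewrite (bigD1 (i', j')) /= ?inE //= => yT.
  have : (y i' j' / entry_sd alpha i' j') ^+ 2 <= k%:R.
    apply: le_trans yT; rewrite lerDl.
    by apply: sumr_ge0 => ij' _; exact: sqr_ge0.
  rewrite expr_div_n ler_pdivrMr ?exprn_gt0 // => y2.
  have {}y2 : y i' j' ^+ 2 <= k%:R * (1 + alpha ^+ 2).
    apply: le_trans y2 _; apply: ler_wpM2l => //.
    rewrite /entry_sd; case: ifP => _; first by rewrite lerDr.
    by rewrite expr1n lerDl sqr_ge0.
  rewrite -real_normK ?num_real // in y2.
  have := normr_ge0 (y i' j'); nra.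
have [|/ltnW ji] := leqP i j; first exact: entry_le.
by rewrite -ysym mxE; exact: entry_le.
Qed.

(** The slack [eta] is at most [eta * #|U|], and [(1 - eta) ^+ 2 * (1 + eta)]
    is at most 1. *)
Lemma limit_body_shrink (eta : R) (x : 'M[R]_k) : 0 <= eta <= 1 -> x^T = x ->
  (forall U : {set 'I_k}, U != finset.set0 ->
     energy U (alpha ^+ 2) x <= #|U|%:R + eta) ->
  body ((1 - eta) *: x).
Proof.
move=> /andP[eta0 eta1] xsym xK; split=> [|U U0].
  by rewrite linearZ /= xsym.
rewrite energyZ; have := xK U U0.
have U1 : 1 <= #|U|%:R :> R by rewrite ler1n card_gt0.
set u := #|U|%:R in U1 *; set E := energy _ _ _ => Eu.
have s0 : 0 <= (1 - eta) ^+ 2 by exact: sqr_ge0.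
apply: (@le_trans _ _ ((1 - eta) ^+ 2 * (u * (1 + eta)))).
  apply: ler_wpM2l => //; nra.
have -> : (1 - eta) ^+ 2 * (u * (1 + eta)) = u * ((1 - eta) * (1 - eta ^+ 2)).
  by ring.
rewrite -[leRHS]mulr1; apply: ler_wpM2l; first by apply: le_trans U1.
have e2 : 0 <= eta ^+ 2 <= 1 by rewrite sqr_ge0 expr_le1.
by move/andP: e2 => [? ?]; apply: mulr_ile1; lra.
Qed.

End LimitBody.

(** Cut the cube of half-side [rho] into cells of side [delta] and choose a
    point of [K] in each cell that meets [K]. *)
Lemma finite_net (R : realType) (k : nat) (K : set 'M[R]_k) (rho delta : R) :
  K !=set0 -> (forall y, K y -> forall i j, `|y i j| <= rho) -> 0 < delta ->
  exists (F : finType) (z : F -> 'M[R]_k), (forall c, K (z c)) /\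
    forall y, K y -> exists c, forall i j, `|y i j - z c i j| <= delta.
Proof.
move=> [z0 Kz0] K_rho d0.
pose N := Num.truncn (2 * rho / delta).
pose F : finType := {ffun 'I_k * 'I_k -> 'I_N.+1}.
pose cell (y : 'M[R]_k) : F :=
  [ffun ij => inord (Num.truncn ((y ij.1 ij.2 + rho) / delta))].
have cellE y i j : K y ->
    (cell y (i, j))%:R <= (y i j + rho) / delta < (cell y (i, j))%:R + 1.
  move=> /K_rho /(_ i j); rewrite ler_norml => /andP[y_ge y_le].
  have y0 : 0 <= (y i j + rho) / delta.
    by rewrite divr_ge0 ?(ltW d0) //; lra.
  rewrite ffunE /= inordK.
    by rewrite natr1; exact: truncn_itv.
  rewrite ltnS; apply: le_truncn; rewrite ler_pM2r ?invr_gt0 //; lra.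
have /choice [z zP] : forall c : F, exists z, K z /\
    forall y, K y -> cell y = c -> forall i j, `|y i j - z i j| <= delta.
  move=> c; have [[z Kz zc]|no] := pselect (exists2 z, K z & cell z = c).
    exists z; split => // y Ky yc i j.
    have := cellE y i j Ky; have := cellE z i j Kz; rewrite yc zc.
    set a := (c (i, j))%:R; rewrite !ler_pdivlMr ?ltr_pdivrMr //.
    move=> /andP[z1 z2] /andP[y1 y2]; rewrite ler_norml; apply/andP; split; lra.
  by exists z0; split => // y Ky yc; case: no; exists y.
exists F, z; split => [c|y Ky]; first by have [] := zP c.
by exists (cell y); have [_] := zP (cell y); exact.
Qed.

(** * Convergence of the cloud *)

Section Cloud.
Context {R : realType} {n k : nat}.
Implicit Types M : 'M[R]_n.

Lemma submx_cloud_perturb M M' (S : {set 'I_n}) (hS : #|S| = k) (r : R) :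
  0 <= r -> (forall i j, `|M' i j - M i j| <= r) ->
  frobenius_dist ((scale_q R n)^-1 *: principal_submx M' hS)
    ((scale_q R n)^-1 *: principal_submx M hS) <=
  k%:R * (`|(scale_q R n)^-1| * r).
Proof.
move=> r0 MM'; apply: frobenius_dist_le => [|i j]; first by rewrite mulr_ge0.
by rewrite !mxE -mulrBr normrM ler_wpM2l.
Qed.

(** For a fixed [S] the point of the cloud is a Lipschitz function of the
    matrix. *)
Lemma hausdorff_gt_open (K : set 'M[R]_k) (eps : R) M :
  (eps%:E < hausdorff_dist (@frobenius_dist R k) (@submx_cloud R n k M) K)%E ->
  exists2 r : R, 0 < r & forall M', (forall i j, `|M' i j - M i j| < r) ->
    (eps%:E < hausdorff_dist (@frobenius_dist R k) (@submx_cloud R n k M') K)%E.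
Proof.
move=> /hausdorff_dist_gtP [e eps_e far].
set q := (scale_q R n)^-1.
have s0 : 0 < k%:R * `|q| + 1 :> R by rewrite ltr_pwDr // mulr_ge0.
pose r := (e - eps) / 2 / (k%:R * `|q| + 1).
have r0 : 0 < r by rewrite !divr_gt0 // subr_gt0.
have r_le : k%:R * (`|q| * r) <= (e - eps) / 2.
  rewrite mulrA /r mulrCA ler_piMr ?divr_ge0 ?subr_ge0 ?(ltW eps_e) //.
  by rewrite ler_pdivrMr // mul1r lerDl.
exists r => // M' MM'; apply/hausdorff_dist_gtP; exists ((e + eps) / 2).
  by lra.
have near (S : {set 'I_n}) (hS : #|S| = k) :
    frobenius_dist (q *: principal_submx M' hS) (q *: principal_submx M hS)
    <= (e - eps) / 2.
  by apply: le_trans r_le; apply: submx_cloud_perturb => [|i j]; exact: ltW.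
case: far => [[_ [S [hS ->]] far]|[y Ky far]]; [left|right].
  exists (q *: principal_submx M' hS); first by exists S, hS.
  move=> y Ky; have := far y Ky; have := near S hS.
  have := frobenius_dist_triangle (q *: principal_submx M' hS)
    (q *: principal_submx M hS) y.
  by rewrite [frobenius_dist _ (q *: principal_submx M' hS)]frobenius_distC; lra.
exists y => // _ [S [hS ->]].
have := far (q *: principal_submx M hS) (ex_intro _ S (ex_intro _ hS erefl)).
have := near S hS.
have := frobenius_dist_triangle (q *: principal_submx M' hS)
  (q *: principal_submx M hS) y.
by rewrite [frobenius_dist _ (q *: principal_submx M' hS)]frobenius_distC; lra.
Qed.

End Cloud.

Lemma expR_ln_cvg0 (R : realType) (C theta : R) : 0 <= C -> 0 < theta ->
  (C * expR (- (theta * ln n%:R))) @[n --> \oo] --> (0 : R).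
Proof.
move=> C0 t0; apply/cvgrPdist_le => e e0.
near=> n.
have n_ge : expR (C / e / theta) <= n%:R by near: n; exact: nbhs_infty_ger.
have L_ge : C / e / theta <= ln n%:R.
  rewrite -[leLHS]expRK ler_ln ?posrE ?expR_gt0 //.
  by apply: lt_le_trans n_ge; exact: expR_gt0.
rewrite sub0r normrN ger0_norm ?mulr_ge0 ?expR_ge0 //.
rewrite expRN ler_pdivrMr ?expR_gt0 // mulrC -ler_pdivrMr //.
apply: le_trans (expR_ge1Dx _).
apply: (@le_trans _ _ (theta * ln n%:R)); last by rewrite lerDr.
by rewrite [leRHS]mulrC -ler_pdivrMr.
Unshelve. all: by end_near.
Qed.

(** A point [x] of the cloud is compared with [(1 - eta) *: x], which is in the
    body.  A point [y] of the body is compared with the net point [z c] near it,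
    then with [(1 - eta) *: z c], then with the cloud. *)
Lemma hausdorff_cloud_le (R : realType) (alpha : R) (k n : nat) (M : 'M[R]_n)
    (F : finType) (z : F -> 'M[R]_k) (rho eta eps : R) :
  0 < alpha -> M^T = M -> 0 < rho -> 0 < eta <= 2^-1 -> 0 < eps ->
  k%:R * (2 * eta * rho) <= eps ->
  (forall (y : 'M[R]_k) i j, limit_body (alpha ^+ 2) y -> `|y i j| <= rho) ->
  (forall c, limit_body (alpha ^+ 2) (z c)) ->
  (forall y, limit_body (alpha ^+ 2) y ->
     exists c, forall i j, `|y i j - z c i j| <= eta * rho / 2) ->
  (forall (S : {set 'I_n}) (hS : #|S| = k) (U : {set 'I_k}),
     U != finset.set0 ->
     energy U (alpha ^+ 2) ((scale_q R n)^-1 *: principal_submx M hS)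
       <= #|U|%:R + eta) ->
  (forall c, exists (S : {set 'I_n}) (hS : #|S| = k), forall i j,
     `|((scale_q R n)^-1 *: principal_submx M hS) i j - (1 - eta) * z c i j|
       <= eta * rho / 2) ->
  (hausdorff_dist (@frobenius_dist R k) (@submx_cloud R n k M)
     (limit_body (alpha ^+ 2)) <= eps%:E)%E.
Proof.
move=> a0 Msym rho0 /andP[eta0 eta_half] eps0 eps_ge K_rho zK net energy_le hit.
have er0 : 0 <= eta * rho by rewrite mulr_ge0 // ltW.
rewrite leNgt; apply/negP => /hausdorff_dist_gtP [e eps_e far].
have close (x y : 'M[R]_k) : (forall i j, `|x i j - y i j| <= 2 * eta * rho) ->
    frobenius_dist x y <= eps.
  move=> xy; apply: le_trans eps_ge; apply: frobenius_dist_le xy.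
  by rewrite -mulrA mulr_ge0.
suff : e <= eps by rewrite leNgt eps_e.
case: far => [[_ [S [hS ->]] far]|[y Ky far]].
  set x := _ *: _ in far *.
  have Ky : limit_body (alpha ^+ 2) ((1 - eta) *: x).
    apply: limit_body_shrink => // [||U U0]; last exact: energy_le.
      by apply/andP; split; lra.
    rewrite /x linearZ /=; congr (_ *: _); apply/matrixP => i j.
    by rewrite !mxE -[in RHS]Msym mxE.
  apply: le_trans (far _ Ky) _; apply: close => i j.
  have := K_rho _ i j Ky; rewrite mxE normrM ger0_norm; last by lra.
  move=> xr; rewrite -{1}[x i j]mul1r -mulrBl opprB addrCA subrr addr0.
  rewrite normrM gtr0_norm //; have := normr_ge0 (x i j); nra.
have [c yc] := net y Ky.
have [S [hS xz]] := hit c.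
apply: le_trans (far _ (ex_intro _ S (ex_intro _ hS erefl))) _.
apply: close => i j; set x := _ *: _ in xz *.
have := xz i j; have := yc i j; have := K_rho _ i j (zK c).
set t := z c i j.
have -> : x i j - y i j = (x i j - (1 - eta) * t) - (y i j - t) - eta * t.
  by ring.
move=> t_le y_le x_le; apply: le_trans (ler_normB _ _) _.
apply: le_trans (lerD (ler_normB _ _) (lexx _)) _.
rewrite [X in _ + X]normrM (gtr0_norm eta0).
have : eta * `|t| <= eta * rho by rewrite ler_pM2l.
by lra.
Qed.

Theorem theorem3 (R : realType) (k : nat) (alpha : R)
    (d : nat -> measure_display) (T : forall n : nat, measurableType (d n))
    (P : forall n : nat, probability (T n) R)
    (A : forall n : nat, 'I_n -> 'I_n -> {RV (P n) >-> R}) :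
  (1 <= k)%N -> 0 < alpha ->
  (forall n : nat, (k <= n)%N -> gaussian_symmetric_ensemble alpha (A n)) ->
  cvg_in_probability P
    (fun n w => hausdorff_dist (@frobenius_dist R k)
       (@submx_cloud R n k (random_matrix (A n) w)) (@limit_body R k (alpha ^+ 2)))
    0.
Proof.
move=> k1 a0 ensA eps eps0.
pose rho : R := 1 + k%:R * (1 + alpha ^+ 2).
have K_rho (y : 'M[R]_k) i j : limit_body (alpha ^+ 2) y -> `|y i j| <= rho.
  by move=> Ky; exact: limit_body_entry_le.
have k0 : 0 < k%:R :> R by rewrite ltr0n.
have rho0 : 0 < rho by rewrite ltr_pwDl // mulr_ge0 // addr_ge0 // sqr_ge0.
(* [eta <= 1 / 2] makes every point of the cloud at most twice as large as its
   contraction, whose entries are bounded by [rho]. *)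
pose eta : R := Num.min 2^-1 (eps / (k%:R * (2 * rho))).
have eta0 : 0 < eta by rewrite lt_min invr_gt0 ltr0n divr_gt0 // !mulr_gt0.
have eta_half : eta <= 2^-1 by rewrite ge_min lexx.
have eta_eps : k%:R * (2 * eta * rho) <= eps.
  have : eta <= eps / (k%:R * (2 * rho)) by rewrite ge_min lexx orbT.
  by rewrite ler_pdivlMr ?mulr_gt0 // => h; apply: le_trans h; lra.
have delta0 : 0 < eta * rho / 2 by rewrite !mulr_gt0.
have [F [z [zK net]]] := @finite_net R k (limit_body (alpha ^+ 2)) rho _
  (ex_intro _ 0 limit_body0) (fun y Ky i j => K_rho y i j Ky) delta0.
have [Cu [Cu0 upper]] := energy_upper_bound k a0 eta0.
have eta01 : 0 < eta <= 1 by rewrite eta0 /=; lra.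
have [Cl [Cl0 lower]] := approximation_bound k1 a0 eta01 delta0.
pose C := Cu + \sum_(c : F) Cl.
have C0 : 0 <= C by rewrite addr_ge0 // sumr_ge0.
apply: (@squeeze_cvge _ _ _ _ (cst 0%E) _
    (fun n => (C * expR (- (eta / 2 * ln n%:R)))%:E)); last 2 first.
- exact: cvg_cst.
- by apply: cvg_EFin; [exact: nearW|apply: expR_ln_cvg0 => //; rewrite divr_gt0].
near=> n.
have kn : (k <= n)%N by near: n; exact: nbhs_infty_ge.
have n2 : (2 <= n)%N by near: n; exact: nbhs_infty_ge.
have L1 : 1 <= ln n%:R :> R.
  have : expR 1 <= n%:R :> R by near: n; exact: nbhs_infty_ger.
  move=> h; rewrite -[leLHS]expRK ler_ln ?posrE ?expR_gt0 //.
  by apply: lt_le_trans h; exact: expR_gt0.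
have ensAn := ensA n kn; rewrite measure_ge0 /=.
pose H w := hausdorff_dist (@frobenius_dist R k)
  (@submx_cloud R n k (random_matrix (A n) w)) (@limit_body R k (alpha ^+ 2)).
have -> : [set w | (eps%:E < `|H w - 0%:E|)%E] = [set w | (eps%:E < H w)%E].
  apply/seteqP; split => w; rewrite /= sube0 gee0_abs //;
    by apply: hausdorff_dist_ge0 => [x y|]; [exact: frobenius_dist_ge0|
      exists 0; exact: limit_body0].
apply: prob_le_of_outer.
  apply: (@measurable_random_matrix_open _ _ _ _ _ (A n)
    ([set M | (eps%:E < hausdorff_dist (@frobenius_dist R k)
      (@submx_cloud R n k M) (limit_body (alpha ^+ 2)))%E])).
  by move=> M; exact: hausdorff_gt_open.
have miss c : xpredT c -> _ := fun _ => lower n _ _ _ (A n) (z c) ensAn kn L1 (zK c).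
have := outer_prob_leU (upper n _ _ _ (A n) ensAn n2)
  (outer_prob_le_exists (index_enum F) miss).
rewrite -mulr_suml -mulrDl -/C; apply: outer_prob_leS (lexx _).
move=> w /= far; apply: contrapT => good; move: far; apply/negP; rewrite -leNgt.
apply: (@hausdorff_cloud_le _ alpha _ _ _ F z rho eta) => //.
- apply/matrixP => i j; rewrite !mxE; have [symA _ _ _] := ensAn; exact: symA.
- by rewrite eta0.
- move=> S hS U U0; rewrite leNgt; apply/negP => E_lt.
  by apply: good; left; exists S, hS, U.
move=> c; apply: contrapT => no; apply: good; right; exists c; split => //.
exact: mem_index_enum.
Unshelve. all: by end_near.
Qed.
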